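(* Let $(\mathcal{M},\varphi,\xi,\eta,g)$ be a weakly para-cosymplectic manifold with $\dim\mathcal{M}=2n+1\geqslant 5$. If $g$ is locally conformally flat, then $\mathcal{M}$ is locally flat, i.e. $R=0$.
   Context: All manifolds, tensor fields and functions are smooth. An almost para-contact metric structure on a manifold $\mathcal{M}$ of dimension $2n+1\geqslant 3$ is a quadruple $(\varphi,\xi,\eta,g)$ consisting of a $(1,1)$-tensor field $\varphi$, a vector field $\xi$, a 1-form $\eta$ and a pseudo-Riemannian metric $g$ with $\varphi^2=Id-\eta\otimes\xi$, $\eta(\xi)=1$, $g(\varphi X,\varphi Y)=-g(X,Y)+\eta(X)\eta(Y)$, $\eta(X)=g(\xi,X)$. The fundamental form is the 2-form $\varPhi(X,Y)=g(\varphi X,Y)$. The manifold is almost para-cosymplectic if $d\eta=0$ and $d\varPhi=0$; an almost para-cosymplectic manifold is weakly para-cosymplectic if $R(X,Y)\varphi Z=\varphi R(X,Y)Z$ for all $X,Y,Z$, where $R(X,Y)Z=\nabla_X\nabla_YZ-\nabla_Y\nabla_XZ-\nabla_{[X,Y]}Z$ is the curvature of the Levi-Civita connection of $g$. *)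

(* Defs.v *)
From HB Require Import structures.
From mathcomp Require Import all_boot all_order all_algebra.
From mathcomp Require Import all_classical all_reals all_analysis.
From mathcomp Require Import ring.

Set Implicit Arguments.
Unset Strict Implicit.
Unset Printing Implicit Defensive.

Import Order.TTheory GRing.Theory Num.Theory.
Import numFieldNormedType.Exports.

Local Open Scope classical_set_scope.
Local Open Scope ring_scope.

(** * Calculus on open subsets of R^m

    Points and vectors of R^m are row vectors, so a (1,1)-tensor with matrix
    [F] sends [v] to [v *m F], a 1-form with column [e] sends [v] to
    [(v *m e) 0 0], and a bilinear form with matrix [G] sends [(u, v)] to
    [(u *m G *m v^T) 0 0]. *)

Section SmoothMaps.
Context {R : realType} {V W : normedModType R}.

(** [D] is meant to be open.  For finite-dimensional [V], the maps ['D_v f]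
    being of class C^k for all [v] means that the derivative of [f] is. *)
Fixpoint C_on (k : nat) (D : set V) (f : V -> W) : Prop :=
  match k with
  | 0 => forall x, D x -> {for x, continuous f}
  | k'.+1 => (forall x, D x -> differentiable f x)
             /\ (forall v, C_on k' D ('D_v f))
  end.

Definition smooth_on (D : set V) (f : V -> W) : Prop := forall k, C_on k D f.

End SmoothMaps.

Section LocalGeometry.
Context {R : realType} {m : nat}.
Local Notation E := 'rV[R]_m.
Implicit Types (G : E -> 'M[R]_m) (X Y Z : E -> E).

Definition form1 (e : 'cV[R]_m) (v : E) : R := (v *m e) 0 0.

Definition form2 (A : 'M[R]_m) (u v : E) : R := (u *m A *m v^T) 0 0.

Definition partial (i : 'I_m) (f : E -> R) : E -> R := 'D_(delta_mx 0 i) f.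

Definition lie_bracket X Y : E -> E :=
  fun x => 'D_(X x) Y x - 'D_(Y x) X x.

(** [christoffel G k i j] is the symbol usually written with [k] up and
    [i], [j] down. *)
Definition christoffel G (k i j : 'I_m) : E -> R := fun x =>
  2^-1 * \sum_l invmx (G x) k l *
    (partial i (fun y => G y j l) x + partial j (fun y => G y i l) x
     - partial l (fun y => G y i j) x).

(** The Levi-Civita connection of [G]; see [nabla_torsion_free] and
    [nabla_metric] below. *)
Definition nabla G X Y : E -> E := fun x =>
  'D_(X x) Y x
  + \row_k \sum_i \sum_j christoffel G k i j x * X x 0 i * Y x 0 j.

Definition curvature G X Y Z : E -> E := fun x =>
  nabla G X (nabla G Y Z) x - nabla G Y (nabla G X Z) x
  - nabla G (lie_bracket X Y) Z x.

Definition d_form1 (e : E -> 'cV[R]_m) X Y : E -> R := fun x =>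
  'D_(X x) (fun y => form1 (e y) (Y y)) x
  - 'D_(Y x) (fun y => form1 (e y) (X y)) x
  - form1 (e x) (lie_bracket X Y x).

Definition d_form2 (A : E -> 'M[R]_m) X Y Z : E -> R := fun x =>
  'D_(X x) (fun y => form2 (A y) (Y y) (Z y)) x
  + 'D_(Y x) (fun y => form2 (A y) (Z y) (X y)) x
  + 'D_(Z x) (fun y => form2 (A y) (X y) (Y y)) x
  - form2 (A x) (lie_bracket X Y x) (Z x)
  - form2 (A x) (lie_bracket Y Z x) (X x)
  - form2 (A x) (lie_bracket Z X x) (Y x).

Lemma form2E (A : 'M[R]_m) (u v : E) :
  form2 A u v = \sum_j (\sum_i u 0 i * A i j) * v 0 j.
Proof.
by rewrite /form2 mxE; apply: eq_bigr => j _; rewrite !mxE.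
Qed.

Lemma partial_dir (f : E -> R) (x v : E) : differentiable f x ->
  'D_v f x = \sum_i v 0 i * partial i f x.
Proof.
move=> df; rewrite deriveE// [in LHS](row_sum_delta v) linear_sum /=.
by apply: eq_bigr => i _; rewrite linearZ /= /partial deriveE.
Qed.

Lemma derive_coord (X : E -> E) (x v : E) (i : 'I_m) : differentiable X x ->
  'D_v (fun y => X y 0 i) x = 'D_v X x 0 i.
Proof. by move=> dX; rewrite derive_mx ?mxE//; exact: diff_derivable. Qed.

Lemma partial_sym G (D : set E) (l i j : 'I_m) (x : E) :
  open D -> (forall y, D y -> (G y)^T = G y) -> D x ->
  partial l (fun y => G y i j) x = partial l (fun y => G y j i) x.
Proof.
move=> oD sG Dx; rewrite /partial; apply: near_eq_derive; near=> y.
have Dy : D y by near: y; exact: open_nbhs_nbhs.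
by rewrite -{1}(sG _ Dy) mxE.
Unshelve. all: by end_near. Qed.

Lemma christoffel_sym G (D : set E) (k i j : 'I_m) (x : E) :
  open D -> (forall y, D y -> (G y)^T = G y) -> D x ->
  christoffel G k i j x = christoffel G k j i x.
Proof.
move=> oD sG Dx; congr (_ * _); apply: eq_bigr => l _; congr (_ * (_ - _)).
  by rewrite addrC.
exact: partial_sym sG Dx.
Qed.

Lemma nabla_torsion_free G (D : set E) X Y (x : E) :
  open D -> (forall y, D y -> (G y)^T = G y) -> D x ->
  nabla G X Y x - nabla G Y X x = lie_bracket X Y x.
Proof.
move=> oD sG Dx; rewrite /nabla /lie_bracket opprD addrACA.
suff -> : \row_k (\sum_i \sum_j christoffel G k i j x * X x 0 i * Y x 0 j) =
  \row_k (\sum_i \sum_j christoffel G k i j x * Y x 0 i * X x 0 j).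
  by rewrite subrr addr0.
apply/rowP => k; rewrite !mxE exchange_big; apply: eq_bigr => i _.
apply: eq_bigr => j _; rewrite (christoffel_sym _ _ _ oD sG Dx)//.
by rewrite mulrAC.
Qed.

Lemma derive_form2 G X Y (x v : E) :
  differentiable X x -> differentiable Y x ->
  (forall i j, differentiable (fun y => G y i j : R) x) ->
  'D_v (fun y => form2 (G y) (X y) (Y y)) x =
    form2 (G x) ('D_v X x) (Y x) + form2 (G x) (X x) ('D_v Y x)
    + \sum_j \sum_i X x 0 i * 'D_v (fun y => G y i j) x * Y x 0 j.
Proof.
move=> dX dY dG.
have dc (Z : E -> E) i : differentiable Z x ->
    is_derive x v (fun y => Z y 0 i) ('D_v Z x 0 i).
  move=> dZ; rewrite -derive_coord//; apply: derivableP.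
  by have /derivable_mxP := diff_derivable (v:=v) dZ; exact.
have dg i j : is_derive x v (fun y => G y i j) ('D_v (fun y => G y i j) x).
  by apply: derivableP; exact: diff_derivable.
have -> : (fun y => form2 (G y) (X y) (Y y)) =
    \sum_j \sum_i ((fun y => X y 0 i) * (fun y => G y i j) * (fun y => Y y 0 j)).
  apply/funext => y; rewrite form2E fct_sumE; apply: eq_bigr => j _.
  by rewrite fct_sumE mulr_suml.
have dS : is_derive x v
    (\sum_j \sum_i ((fun y => X y 0 i) * (fun y => G y i j) * (fun y => Y y 0 j)))
    (\sum_j \sum_i ((X x 0 i * G x i j) *: 'D_v Y x 0 j
       + Y x 0 j *: (X x 0 i *: 'D_v (fun y => G y i j) x
                    + G x i j *: 'D_v X x 0 i))).
  apply: is_derive_sum => j; apply: is_derive_sum => i.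
  have dXG := is_deriveM (dc X i dX) (dg i j).
  exact: (is_deriveM dXG (dc Y j dY)).
rewrite (derive_val (is_derive := dS)) !form2E -!big_split /=.
apply: eq_bigr => j _; rewrite !mulr_suml -!big_split /=; apply: eq_bigr => i _.
by rewrite /GRing.scale /=; ring.
Qed.

Lemma nabla_metric G (D : set E) X Y Z (x : E) :
  open D -> (forall y, D y -> (G y)^T = G y) -> D x ->
  G x \in unitmx -> (forall i j, differentiable (fun y => G y i j : R) x) ->
  differentiable X x -> differentiable Y x ->
  'D_(Z x) (fun y => form2 (G y) (X y) (Y y)) x =
    form2 (G x) (nabla G Z X x) (Y x) + form2 (G x) (X x) (nabla G Z Y x).
Proof.
move=> oD sG Dx uG dG dX dY; rewrite derive_form2// /nabla.
have addl (A : 'M[R]_m) (u v w : E) :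
    form2 A (u + v) w = form2 A u w + form2 A v w.
  by rewrite /form2 !mulmxDl mxE.
have form2C (u w : E) : form2 (G x) u w = form2 (G x) w u.
  have tr00 (a : 'M[R]_1) : a 0 0 = a^T 0 0 by rewrite mxE.
  rewrite /form2 [LHS]tr00.
  by rewrite !trmx_mul !trmxK sG// mulmxA.
pose L (u w : E) : E := \row_l (2^-1 * \sum_i \sum_j u 0 i * w 0 j *
  (partial i (fun y => G y j l) x + partial j (fun y => G y i l) x
   - partial l (fun y => G y i j) x)).
have LE (u w : E) : (\row_k \sum_i \sum_j christoffel G k i j x * u 0 i * w 0 j)
    = L u w *m invmx (G x).
  have sI : (invmx (G x))^T = invmx (G x) by rewrite trmx_inv sG.
  apply/rowP => k; rewrite !mxE.
  under [RHS]eq_bigr do rewrite mxE -mulrA mulr_suml mulr_sumr.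
  rewrite [RHS]exchange_big /=; apply: eq_bigr => i _.
  under [RHS]eq_bigr do rewrite mulr_suml mulr_sumr.
  rewrite [RHS]exchange_big /=; apply: eq_bigr => j _.
  rewrite /christoffel -mulrA mulr_sumr mulr_suml; apply: eq_bigr => l _.
  rewrite -[in RHS]sI mxE; ring.
have GE (u w t : E) : form2 (G x) (L u w *m invmx (G x)) t = (L u w *m t^T) 0 0.
  by rewrite /form2 mulmxKV.
rewrite !LE addl GE [X in _ = _ + X]form2C addl GE [form2 _ _ (X x)]form2C.
rewrite addrACA; congr (_ + _).
transitivity (\sum_j \sum_i \sum_l
    Z x 0 l * X x 0 i * Y x 0 j * partial l (fun y => G y i j) x).
  apply: eq_bigr => j _; apply: eq_bigr => i _.
  rewrite partial_dir// mulr_sumr mulr_suml; apply: eq_bigr => l _; ring.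
pose S (i j l : 'I_m) := partial i (fun y => G y j l) x.
have SC i j l : S i j l = S i l j by exact: partial_sym sG Dx.
pose T i j l := 2^-1 * (Z x 0 i * X x 0 j * Y x 0 l).
have e1 : (L (Z x) (X x) *m (Y x)^T) 0 0 =
    \sum_l \sum_i \sum_j T i j l * (S i j l + S j i l - S l i j).
  rewrite mxE; apply: eq_bigr => l _; rewrite !mxE -mulrA mulr_suml mulr_sumr.
  apply: eq_bigr => i _; rewrite mulr_suml mulr_sumr; apply: eq_bigr => j _.
  by rewrite /T /S; ring.
have e2 : (L (Z x) (Y x) *m (X x)^T) 0 0 =
    \sum_l \sum_i \sum_j T i j l * (S i l j + S l i j - S j i l).
  transitivity (\sum_j \sum_i \sum_l T i j l * (S i l j + S l i j - S j i l)).
    rewrite mxE; apply: eq_bigr => l _; rewrite !mxE -mulrA mulr_suml mulr_sumr.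
    apply: eq_bigr => i _; rewrite mulr_suml mulr_sumr; apply: eq_bigr => j _.
    by rewrite /T /S; ring.
  rewrite exchange_big /= [RHS]exchange_big /=; apply: eq_bigr => i _.
  by rewrite exchange_big.
transitivity (\sum_l \sum_i \sum_j 2 * T i j l * S i j l).
  apply: eq_bigr => l _; rewrite exchange_big /=; apply: eq_bigr => i _.
  apply: eq_bigr => j _; rewrite /T /S mulrA divff ?pnatr_eq0// mul1r; ring.
rewrite e1 e2 -big_split; apply: eq_bigr => l _ /=.
rewrite -big_split; apply: eq_bigr => i _ /=.
rewrite -big_split; apply: eq_bigr => j _ /=.
by rewrite (SC i l j); ring.
Qed.

End LocalGeometry.

(** * Smooth manifolds *)

(** A Hausdorff second-countable space with a smooth atlas indexed by [chart];
    [coord_inv c] is only meaningful on the image of the domain of [c]. *)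
Record smooth_manifold (R : realType) (m : nat) := SmoothManifold {
  carrier :> topologicalType;
  chart : Type;
  dom : chart -> set carrier;
  coord : chart -> carrier -> 'rV[R]_m;
  coord_inv : chart -> 'rV[R]_m -> carrier;
  carrier_hausdorff : hausdorff_space carrier;
  carrier_second_countable : @second_countable carrier;
  dom_cover : forall p : carrier, exists c, dom c p;
  dom_open : forall c, open (dom c);
  coord_open : forall c, open (coord c @` dom c);
  coordK : forall c p, dom c p -> coord_inv c (coord c p) = p;
  coord_continuous : forall c p, dom c p -> {for p, continuous (coord c)};
  coord_inv_continuous : forall c x, (coord c @` dom c) x ->
    {for x, continuous (coord_inv c)};
  transition_smooth : forall c d,
    smooth_on (coord c @` (dom c `&` dom d)) (coord d \o coord_inv c)
}.

Arguments chart {R m} M : rename.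
Arguments dom {R m M} c : rename.
Arguments coord {R m M} c p : rename.
Arguments coord_inv {R m M} c x : rename.

Section Tensors.
Context {R : realType} {m : nat} (M : smooth_manifold R m).
Local Notation E := 'rV[R]_m.

Definition chart_image (c : chart M) (U : set M) : set E :=
  coord c @` (U `&` dom c).

(** The tangent map at [p] of the change of coordinates from [c] to [d]. *)
Definition transition_diff (c d : chart M) (p : M) : E -> E :=
  'd (coord d \o coord_inv c : E -> E) (coord c p).

Definition smooth_fun_on (U : set M) (f : M -> R) : Prop :=
  forall c, smooth_on (chart_image c U) (f \o coord_inv c).

(** A tensor field is given by its smooth component functions in every chart,
    related by the change of coordinates wherever two charts overlap. *)

Definition is_vector_field (X : chart M -> E -> E) : Prop :=
  (forall c, smooth_on (chart_image c setT) (X c)) /\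
  (forall c d p, dom c p -> dom d p ->
    X d (coord d p) = transition_diff c d p (X c (coord c p))).

Definition is_1form (e : chart M -> E -> 'cV[R]_m) : Prop :=
  (forall c, smooth_on (chart_image c setT) (e c)) /\
  (forall c d p u, dom c p -> dom d p ->
    form1 (e d (coord d p)) (transition_diff c d p u)
    = form1 (e c (coord c p)) u).

Definition is_tensor11 (F : chart M -> E -> 'M[R]_m) : Prop :=
  (forall c, smooth_on (chart_image c setT) (F c)) /\
  (forall c d p u, dom c p -> dom d p ->
    transition_diff c d p u *m F d (coord d p)
    = transition_diff c d p (u *m F c (coord c p))).

Definition is_tensor02 (A : chart M -> E -> 'M[R]_m) : Prop :=
  (forall c, smooth_on (chart_image c setT) (A c)) /\
  (forall c d p u v, dom c p -> dom d p ->
    form2 (A d (coord d p)) (transition_diff c d p u) (transition_diff c d p v)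
    = form2 (A c (coord c p)) u v).

Definition is_pseudo_riemannian (g : chart M -> E -> 'M[R]_m) : Prop :=
  [/\ is_tensor02 g,
      forall c x, chart_image c setT x -> (g c x)^T = g c x &
      forall c x, chart_image c setT x -> g c x \in unitmx].

(** [R = 0] on the open set [U].  Here and below, vector fields are taken on
    the domain of a chart, through their components in that chart. *)
Definition flat_on (U : set M) (g : chart M -> E -> 'M[R]_m) : Prop :=
  forall (c : chart M) (X Y Z : E -> E),
    smooth_on (chart_image c U) X -> smooth_on (chart_image c U) Y ->
    smooth_on (chart_image c U) Z ->
    forall x, chart_image c U x -> curvature (g c) X Y Z x = 0.

Definition locally_flat (g : chart M -> E -> 'M[R]_m) : Prop := flat_on setT g.

Definition conformal_metric (f : M -> R) (g : chart M -> E -> 'M[R]_m) :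
    chart M -> E -> 'M[R]_m :=
  fun c x => expR (2 * f (coord_inv c x)) *: g c x.

Definition locally_conformally_flat (g : chart M -> E -> 'M[R]_m) : Prop :=
  forall p : M, exists (U : set M) (f : M -> R),
    [/\ open U, U p, smooth_fun_on U f & flat_on U (conformal_metric f g)].

Definition almost_para_contact_metric (phi : chart M -> E -> 'M[R]_m)
    (xi : chart M -> E -> E) (eta : chart M -> E -> 'cV[R]_m)
    (g : chart M -> E -> 'M[R]_m) : Prop :=
  [/\ is_tensor11 phi, is_vector_field xi, is_1form eta &
      is_pseudo_riemannian g] /\
  forall c x, chart_image c setT x ->
    [/\ forall u, u *m phi c x *m phi c x = u - form1 (eta c x) u *: xi c x,
        form1 (eta c x) (xi c x) = 1,
        forall u v, form2 (g c x) (u *m phi c x) (v *m phi c x)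
          = - form2 (g c x) u v + form1 (eta c x) u * form1 (eta c x) v &
        forall u, form1 (eta c x) u = form2 (g c x) (xi c x) u].

(** The matrix of [Phi (X, Y) = g (phi X, Y)]. *)
Definition fundamental_form (phi g : chart M -> E -> 'M[R]_m) :
    chart M -> E -> 'M[R]_m :=
  fun c x => phi c x *m g c x.

Definition closed_1form (e : chart M -> E -> 'cV[R]_m) : Prop :=
  forall (c : chart M) (X Y : E -> E),
    smooth_on (chart_image c setT) X -> smooth_on (chart_image c setT) Y ->
    forall x, chart_image c setT x -> d_form1 (e c) X Y x = 0.

Definition closed_2form (A : chart M -> E -> 'M[R]_m) : Prop :=
  forall (c : chart M) (X Y Z : E -> E),
    smooth_on (chart_image c setT) X -> smooth_on (chart_image c setT) Y ->
    smooth_on (chart_image c setT) Z ->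
    forall x, chart_image c setT x -> d_form2 (A c) X Y Z x = 0.

Definition almost_para_cosymplectic (phi : chart M -> E -> 'M[R]_m)
    (xi : chart M -> E -> E) (eta : chart M -> E -> 'cV[R]_m)
    (g : chart M -> E -> 'M[R]_m) : Prop :=
  [/\ almost_para_contact_metric phi xi eta g, closed_1form eta &
      closed_2form (fundamental_form phi g)].

Definition weakly_para_cosymplectic (phi : chart M -> E -> 'M[R]_m)
    (xi : chart M -> E -> E) (eta : chart M -> E -> 'cV[R]_m)
    (g : chart M -> E -> 'M[R]_m) : Prop :=
  almost_para_cosymplectic phi xi eta g /\
  forall (c : chart M) (X Y Z : E -> E),
    smooth_on (chart_image c setT) X -> smooth_on (chart_image c setT) Y ->
    smooth_on (chart_image c setT) Z ->
    forall x, chart_image c setT x ->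
      curvature (g c) X Y (fun y => Z y *m phi c y) x
      = curvature (g c) X Y Z x *m phi c x.

End Tensors.

(* Main.v *)
Require Import Defs.
From mathcomp Require Import all_boot all_order all_algebra.
From mathcomp Require Import all_classical all_reals all_analysis.
From mathcomp Require Import ring lra.

(** If [exp(2f) g] is flat, the conformal change of the Levi-Civita connection
    gives [R(u,v)w = T(v,w)u - T(u,w)v + g(v,w)Qu - g(u,w)Qv] with
    [T = Hess f - df.df + |df|^2/2 g] and [Q] the endomorphism dual to [T].
    Tracing [R(u,v)phi w = phi R(u,v)w] over [u] gives
    [(m-3) T(v,phi w) + T(phi v,w) + t g(v,phi w) = 0], [t = tr Q], [m = 2n+1],
    because [phi] is skew and [T] symmetric.  As [m-3 <> 1], this forces [T] to be
    [mu g + nu eta.eta]; then [phi R(u,xi)xi = 0] and the value of [t] give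
    [2 mu + nu = 0] and [(m-3) mu = 0], so [T = 0] and [R = 0]. *)

Import Order.TTheory GRing.Theory Num.Theory.
Import numFieldNormedType.Exports.
Set Implicit Arguments.
Unset Strict Implicit.
Unset Printing Implicit Defensive.

(** The conclusion is reached by linear algebra in one tangent space; analysis serves only to get
    there. All hypotheses speak of vector fields, so the curvature has to be replaced by a trilinear
    map at a point, and symmetry of second derivatives is what makes this possible. The trace over
    [u] is the right contraction because a skew [phi] has no trace and neither does [Q phi]: the
    endomorphism [Q] then survives only through the scalar [t] and through its dual form [T], which
    leaves a linear relation in [T]. The contraction loses information in the direction of [xi],
    where [phi] vanishes. This is why the uncontracted relation is used once more, at [v = w = xi],
    to tie the value [T(xi, xi)] to the factor of [g]. *)

Section Form2.
Local Open Scope ring_scope.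
Context {R : realType} {m : nat}.
Implicit Types (A B : 'M[R]_m) (u v w : 'rV[R]_m).

Lemma form2Dl A u v w : form2 A (u + v) w = form2 A u w + form2 A v w.
Proof. by rewrite /form2 !mulmxDl mxE. Qed.

Lemma form2Dr A u v w : form2 A w (u + v) = form2 A w u + form2 A w v.
Proof. by rewrite /form2 linearD mulmxDr mxE. Qed.

Lemma form2Zl A a u w : form2 A (a *: u) w = a * form2 A u w.
Proof. by rewrite /form2 -!scalemxAl mxE. Qed.

Lemma form2Zr A a u w : form2 A w (a *: u) = a * form2 A w u.
Proof. by rewrite /form2 linearZ /= -scalemxAr mxE. Qed.

Lemma form2_sym A u v : A^T = A -> form2 A u v = form2 A v u.
Proof.
move=> sA; have tr00 (a : 'M[R]_1) : a 0 0 = a^T 0 0 by rewrite mxE.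
by rewrite /form2 [LHS]tr00 !trmx_mul !trmxK sA mulmxA.
Qed.

Lemma form2_mull A B u v : form2 A (u *m B) v = form2 (B *m A) u v.
Proof. by rewrite /form2 !mulmxA. Qed.

Lemma form2_mulr A B u v : form2 A u (v *m B) = form2 (A *m B^T) u v.
Proof. by rewrite /form2 trmx_mul !mulmxA. Qed.

Lemma form2_delta A i j : form2 A (delta_mx 0 i) (delta_mx 0 j) = A i j.
Proof. by rewrite /form2 -rowE trmx_delta -colE !mxE. Qed.

Lemma form2_ext A B : (forall u v, form2 A u v = form2 B u v) -> A = B.
Proof. by move=> AB; apply/matrixP => i j; rewrite -2!form2_delta. Qed.

Lemma form2DA A B u v : form2 (A + B) u v = form2 A u v + form2 B u v.
Proof. by rewrite /form2 mulmxDr mulmxDl mxE. Qed.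

Lemma form2ZA a A u v : form2 (a *: A) u v = a * form2 A u v.
Proof. by rewrite /form2 -scalemxAr -scalemxAl mxE. Qed.

Lemma form2NA A u v : form2 (- A) u v = - form2 A u v.
Proof. by rewrite -scaleN1r form2ZA mulN1r. Qed.

Lemma mxtrace_form2 A u v : \tr (A *m v^T *m u) = form2 A u v.
Proof. by rewrite mxtrace_mulC mulmxA /mxtrace big_ord1. Qed.

Lemma form2_nondeg A u : A \in unitmx -> (forall v, form2 A u v = 0) -> u = 0.
Proof.
move=> uA u0; rewrite -[u](mulmxK uA).
suff -> : u *m A = 0 by rewrite mul0mx.
by apply/rowP => i; have := u0 (delta_mx 0 i); rewrite /form2 trmx_delta -colE !mxE.
Qed.

End Form2.

(* The Kulkarni-Nomizu product of [G] and [T], one index raised; it is used with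
   [Q *m G = T]. *)
Definition kn_curv (R : realType) (m : nat) (G T Q : 'M[R]_m)
    (u v w : 'rV[R]_m) : 'rV[R]_m :=
  (form2 T v w *: u - form2 T u w *: v
   + (form2 G v w *: (u *m Q) - form2 G u w *: (v *m Q)))%R.

(** * Linear algebra of a para-contact structure at one point *)

Section ParaContactAlgebra.
Local Open Scope ring_scope.
Context {R : realType} {m : nat}.
Variables (F G T Q : 'M[R]_m) (x : 'rV[R]_m) (e : 'cV[R]_m).
Hypothesis m_gt4 : (4 < m)%N.
Hypothesis F2 : forall u, u *m F *m F = u - form1 e u *: x.
Hypothesis ex1 : form1 e x = 1.
Hypothesis FG : forall u v,
  form2 G (u *m F) (v *m F) = - form2 G u v + form1 e u * form1 e v.
Hypothesis eE : forall u, form1 e u = form2 G x u.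
Hypotheses (sG : G^T = G) (uG : G \in unitmx) (sT : T^T = T) (QG : Q *m G = T).
Hypothesis kn_comm : forall u v w,
  kn_curv G T Q u v (w *m F) = kn_curv G T Q u v w *m F.

(** Since [phi^2 xi = 0], the formula for [phi^2] at [phi xi] forces [phi xi = c xi]; applying [phi]
    once more gives [c^2 xi = 0]. *)
Let xF0 : x *m F = 0.
Proof.
have xFF : x *m F *m F = 0 by rewrite F2 ex1 scale1r subrr.
have := F2 (x *m F); rewrite xFF mul0mx => /esym/eqP; rewrite subr_eq0.
move: (form1 e _) => c /eqP h.
move: (xFF); rewrite h -scalemxAl h scalerA => /eqP.
rewrite scaler_eq0 mulf_eq0 orbb => /orP[/eqP ->|/eqP ->]; first by rewrite scale0r.
by rewrite scaler0.
Qed.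

Let x_neq0 : x != 0.
Proof.
apply/eqP => x0; have := ex1; rewrite x0 /form1 mul0mx mxE => /eqP.
by rewrite eq_sym oner_eq0.
Qed.

(** Evaluating [phi^3 u] as [phi^2 (phi u)] and as [phi (phi^2 u)] leaves the difference
    [eta(phi u) xi], and [xi] is nonzero. *)
Let eF0 u : form1 e (u *m F) = 0.
Proof.
have := F2 (u *m F); rewrite [u *m F *m F]F2 mulmxBl -scalemxAl xF0 scaler0 subr0.
move=> /eqP; rewrite eq_sym subr_eq addrC -subr_eq subrr eq_sym scaler_eq0.
by rewrite (negPf x_neq0) orbF => /eqP.
Qed.

(** Put [phi v] for [v] in the compatibility of [phi] with [g]: the [xi] component of [phi^2 v] is
    orthogonal to the image of [phi]. *)
Let F_skew : F *m G = - (G *m F^T).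
Proof.
apply: form2_ext => u v; rewrite form2NA -form2_mull -form2_mulr.
have := FG u (v *m F); rewrite F2 eF0 mulr0 addr0 => <-.
rewrite -scaleN1r scalerA mulN1r form2Dr form2Zr.
by rewrite (form2_sym _ x sG) -eE eF0 mulr0 addr0.
Qed.

Let QE : Q = T *m invmx G.
Proof. by rewrite -QG mulmxK. Qed.

(** A self-adjoint endomorphism composed with a skew one has a trace equal to its own opposite. The
    case [S = G] gives [tr phi = 0] and the case [S = T] gives [tr (Q phi) = 0]. *)
Let trFS (S : 'M[R]_m) : S^T = S -> \tr (S *m invmx G *m F) = 0.
Proof.
move=> sS; apply/eqP.
have: \tr (S *m invmx G *m F) = - \tr (S *m invmx G *m F).
  rewrite -[in LHS](mulmxK uG F) F_skew mulNmx mulmxN !mulmxA mulmxKV// linearN /=.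
  rewrite -mxtrace_tr 2!trmx_mul trmxK trmx_inv sG sS.
  by rewrite mxtrace_mulC -mulmxA mxtrace_mulC.
lra.
Qed.

Let trF : \tr F = 0.
Proof. by rewrite -(trFS sG) mulmxV// mul1mx. Qed.

Let trQF : \tr (Q *m F) = 0.
Proof. by rewrite QE trFS. Qed.

(* Trace over [u] of the commutation relation. *)
Let ricci_comm : (m%:R - 2) *: (T *m F^T) + \tr Q *: (G *m F^T) =
  T *m F^T - F *m T.
Proof.
(* [K v w] is the matrix of the endomorphism sending [u] to [R(u,v)w], so that contraction over [u]
   becomes [\tr]. *)
pose K v w := (form2 T v w)%:M - T *m w^T *m v
  + (form2 G v w *: Q - G *m w^T *m (v *m Q)).
have KE u v w : u *m K v w = kn_curv G T Q u v w.
  have outer A y z : u *m (A *m y^T *m z) = form2 A u y *: z.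
    by rewrite !mulmxA /form2 [in LHS](mx11_scalar (u *m A *m y^T)) mul_scalar_mx.
  by rewrite /K mulmxDr !mulmxBr !outer mul_mx_scalar -scalemxAr.
have KF v w : K v (w *m F) = K v w *m F.
  by apply/row_matrixP => i; rewrite !rowE mulmxA !KE.
(* The left trace is the Ricci form [(m - 2) T + t G] at [(v, phi w)]. On the right only the two
   rank-one terms contribute. *)
apply: form2_ext => v w; have := congr1 mxtrace (KF v w).
rewrite /K !mulmxDl !mulNmx !mxtraceD !raddfN /= -!scalemxAl !mxtraceZ trQF.
rewrite !mulmxA -[T *m w^T *m v *m F]mulmxA -[G *m w^T *m v *m Q *m F]mulmxA.
rewrite -[_ *m v *m (Q *m F)]mulmxA -[_ *m v *m Q]mulmxA.
rewrite !mxtrace_form2 mul_scalar_mx mxtraceZ trF mxtrace_scalar.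
rewrite !form2_mull !form2_mulr QG -mulmxA F_skew mulmxN mulmxA QG.
rewrite !(form2DA, form2NA, form2ZA) -mulr_natr; lra.
Qed.

(** As [T] is symmetric, [A = F T] and [B = T F^T] are transposes of each other, while [C = F G] is
    antisymmetric. The trace relation and its transpose thus form a linear system in [A] and [B] of
    determinant [(m-3)^2 - 1 = (m-2)(m-4)]. Their sum gives [B = - A], and substituting back leaves
    the factor [m - 4]. *)
Let tF_FT : (m%:R - 4) *: (F *m T) = - \tr Q *: (F *m G).
Proof.
pose A := F *m T; pose C := F *m G; pose t := \tr Q; pose B := T *m F^T.
have GF : G *m F^T = - C by rewrite /C F_skew opprK.
have hB : (m%:R - 3) *: B = t *: C - A.
  have := ricci_comm; rewrite -/A -/B -/t GF => h.
  apply/matrixP => i j; move/matrixP: h => /(_ i j); rewrite !mxE; lra.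
have BT : B^T = A by rewrite /B trmx_mul trmxK sT.
have CT : C^T = - C by rewrite -GF /C trmx_mul sG.
have hA : (m%:R - 3) *: A = - (t *: C) - B.
  have := congr1 trmx hB; rewrite linearB !linearZ /= BT CT scalerN => ->.
  by rewrite -BT trmxK.
have m2 : m%:R - 2 != 0 :> R.
  by rewrite subr_eq0 eqr_nat; case: (m) m_gt4 => [|[|[|]]].
rewrite -/A -/C -/t; clearbody A B C t; apply/matrixP => i j.
move/matrixP: hA => /(_ i j); move/matrixP: hB => /(_ i j).
rewrite !mxE => hBij hAij.
have AB : (m%:R - 2) * (A i j + B i j) = 0 by lra.
have /eqP := AB; rewrite mulf_eq0 (negPf m2) /= => /eqP ABij; lra.
Qed.

Lemma para_kn_tensor0 : T = 0.
Proof.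
pose c := form2 T x x; pose mu := - \tr Q / (m%:R - 4).
have m5 : 5 <= m%:R :> R by rewrite ler_nat.
have m4 : m%:R - 4 != 0 :> R by apply/eqP; lra.
have eeE u w : form2 (e *m e^T) u w = form1 e u * form1 e w.
  rewrite /form2 !mulmxA -mulmxA -trmx_mul [w *m e]mx11_scalar tr_scalar_mx.
  by rewrite mul_mx_scalar mxE mulrC.
(* [tF_FT] says that [T = mu G] as soon as one argument lies in the image of [phi]; it is applied
   here to [phi^2 u = u - eta(u) xi]. *)
have hT u w : form2 T u w - form1 e u * form2 T x w
    = mu * (form2 G u w - form1 e u * form1 e w).
  have /(congr1 (fun M => form2 M (u *m F) w)) := tF_FT.
  rewrite !form2ZA -!form2_mull F2 -scaleNr !form2Dl !form2Zl -eE => h.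
  apply: (mulfI m4); rewrite /mu mulrA [_ * (_ / _)]mulrC divfK//.
  by rewrite -[LHS]addr0; lra.
have hx w : form2 T x w = c * form1 e w.
  rewrite (form2_sym _ _ sT); have := hT w x; rewrite -/c ex1.
  by rewrite [form2 G w x]form2_sym// -eE; lra.
have TE : T = mu *: G + (c - mu) *: (e *m e^T).
  apply: form2_ext => u w; rewrite form2DA !form2ZA eeE.
  by have := hT u w; rewrite hx; lra.
have QE' : Q = mu%:M + (c - mu) *: (e *m x).
  have eT : e^T = x *m G.
    apply/rowP => i; have := eE (delta_mx 0 i).
    by rewrite /form1 /form2 trmx_delta -rowE -colE !mxE.
  by rewrite QE TE mulmxDl -!scalemxAl mulmxV// eT mulmxA mulmxK// scalemx1.
have uQ u : u *m Q = mu *: u + (c - mu) * form1 e u *: x.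
  rewrite QE' mulmxDr mul_mx_scalar -scalemxAr mulmxA; congr (_ + _).
  by rewrite [u *m e]mx11_scalar mul_scalar_mx scalerA.
have trQ : \tr Q = mu * m%:R + (c - mu).
  rewrite QE' mxtraceD mxtrace_scalar mxtraceZ mxtrace_mulC /mxtrace big_ord1.
  by rewrite -[(x *m e) 0 0]/(form1 e x) ex1 mulr1 mulr_natr.
(* If [phi] vanished, the identity would be [eta] tensor [xi], of trace 1 instead of [m]. *)
have Fn0 : exists u : 'rV_m, u *m F != 0.
  apply: contrapT => nF; have F0 (u : 'rV_m) : u *m F = 0.
    by apply/eqP; apply: contraT => uF; case: nF; exists u.
  have h : (1%:M : 'M[R]_m) = e *m x.
    apply/row_matrixP => i; rewrite !rowE mulmx1 mulmxA.
    have := F2 (delta_mx 0 i).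
    rewrite F0 => /esym/eqP; rewrite subr_eq0 => /eqP {1}->.
    by rewrite [_ *m e]mx11_scalar mul_scalar_mx.
  have := congr1 mxtrace h; rewrite mxtrace1 mxtrace_mulC /mxtrace big_ord1.
  by rewrite -[(x *m e) 0 0]/(form1 e x) ex1; lra.
have [u uF] := Fn0.
(* [R(u,xi)xi] is [c + mu] times the projection of [u] along [xi], and [phi] kills it because
   [phi xi = 0]; a [u] with [phi u] nonzero then isolates the scalar. *)
have cmu : c + mu = 0.
  have kx : kn_curv G T Q u x x = (c + mu) *: (u - form1 e u *: x).
    rewrite /kn_curv !uQ hx -[form2 T u x](form2_sym _ _ sT) hx ex1 -eE ex1.
    rewrite [form2 G u x]form2_sym// -eE -/c.
    by apply/rowP => i; rewrite !mxE; ring.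
  have := kn_comm u x x; rewrite xF0 kx.
  have -> : kn_curv G T Q u x 0 = 0.
    have f0 (A : 'M[R]_m) y : form2 A y 0 = 0 by rewrite /form2 trmx0 mulmx0 mxE.
    by rewrite /kn_curv !f0 !scale0r !subr0 addr0.
  rewrite -scalemxAl mulmxBl -scalemxAl xF0 scaler0 subr0 => /esym/eqP.
  by rewrite scaler_eq0 (negPf uF) orbF => /eqP.
(* With [c = - mu] the trace of [Q] is [(m-2) mu], whereas the definition of [mu] makes it
   [-(m-4) mu]. The difference is [2 (m-3) mu], which would say nothing in dimension 3. *)
have mu0 : mu = 0.
  have : mu * (m%:R - 4) = - \tr Q by rewrite /mu divfK.
  have m3 : m%:R - 3 != 0 :> R by apply/eqP; lra.
  by rewrite trQ => h; apply: (mulIf m3); nra.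
by rewrite TE (_ : c - mu = 0) ?mu0 ?scale0r ?addr0//; lra.
Qed.

End ParaContactAlgebra.

(** * Symmetry of second derivatives *)

Section Schwarz.
Local Open Scope ring_scope.
Local Open Scope classical_set_scope.
Context {R : realType} {V : normedModType R}.
Implicit Types (f : V -> R) (D : set V).

Lemma is_derive_line (W : normedModType R) (f : V -> W) (y u : V) (t : R) :
  differentiable f (t *: u + y) ->
  is_derive t 1 (fun s => f (s *: u + y)) ('D_u f (t *: u + y)).
Proof.
move=> df; have := derivableP (diff_derivable (v := u) df).
have E : (fun h : R => h^-1 *: (((fun s => f (s *: u + y)) \o shift t) (h *: (1 : R))
    - f (t *: u + y))) =
  (fun h : R => h^-1 *: ((f \o shift (t *: u + y)) (h *: u) - f (t *: u + y))).
  by apply/funext => h /=; rewrite [h *: 1]mulr1 scalerDl addrA.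
case=> d1 _; split; first by rewrite /derivable E.
by rewrite /derive E.
Qed.

Let second_diff f (x u v : V) (s : R) :=
  f (s *: u + (s *: v + x)) - f (s *: u + x) - f (s *: v + x) + f x.

(** Two uses of the one-variable mean value theorem, along [u] for the difference of [f] on two
    parallel segments and then along [v] for ['D_u f], make the quotient equal to ['D_v ('D_u f)] at
    some [c *: u + (d *: v + x)]. Continuity of that derivative at [x] concludes. *)
Let second_diff_near f D x u v (e : R) : open D -> C_on 2 D f -> D x -> 0 < e ->
  exists2 r : R, 0 < r & forall s, 0 < s < r ->
    `|second_diff f x u v s / s ^+ 2 - 'D_v ('D_u f) x| < e.
Proof.
move=> oD [df /(_ u)[dDf /(_ v) cDf]] Dx e0.
have : \forall y \near x, D y /\ `|'D_v ('D_u f) x - 'D_v ('D_u f) y| < e.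
  apply: filterI; first exact: open_nbhs_nbhs.
  by have /cvgrPdist_lt/(_ _ e0) := cDf x Dx.
move=> /nbhs_ballP[r /= r0 xr].
have nuv : 0 < `|u| + `|v| + 1 by rewrite ltr_wpDl// addr_ge0.
(* This radius keeps the whole parallelogram spanned by [s *: u] and [s *: v] in the ball; the added
   1 covers [u = v = 0]. *)
exists (r / (`|u| + `|v| + 1)) => [|s /andP[s0 sr]]; first exact: divr_gt0.
have inb a b : 0 <= a <= s -> 0 <= b <= s ->
    D (a *: u + (b *: v + x)) /\
    `|'D_v ('D_u f) x - 'D_v ('D_u f) (a *: u + (b *: v + x))| < e.
  move=> /andP[a0 a1] /andP[b0 b1]; apply: xr.
  rewrite -ball_normE /= distrC addrA addrK.
  move: sr; rewrite ltr_pdivlMr// => sr; apply: le_lt_trans sr.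
  rewrite (le_trans (ler_normD _ _))// !normrZ ger0_norm// [`|b|]ger0_norm//.
  have := normr_ge0 u; have := normr_ge0 v; nra.
have s00 : 0 <= (0 : R) <= s by rewrite lexx ltW.
have sss : 0 <= s <= s by rewrite ltW //=.
have [c cs Ec] : exists2 c, c \in `]0, s[%R & second_diff f x u v s =
    ('D_u f (c *: u + (s *: v + x)) - 'D_u f (c *: u + x)) * s.
  pose F t := f (t *: u + (s *: v + x)) - f (t *: u + x).
  have dF t : 0 <= t <= s -> is_derive t 1 F
      ('D_u f (t *: u + (s *: v + x)) - 'D_u f (t *: u + x)).
    move=> ts; apply: is_deriveB; apply: is_derive_line; apply: df.
      by have [] := inb _ _ ts sss.
    by have [+ _] := inb _ _ ts s00; rewrite scale0r add0r.
  have cF : {within `[0, s], continuous F}.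
    by apply: derivable_within_continuous => t; rewrite in_itv/= => /dF[].
  have {}dF t : t \in `]0, s[%R -> is_derive t 1 F
      ('D_u f (t *: u + (s *: v + x)) - 'D_u f (t *: u + x)).
    by rewrite in_itv /= => /andP[/ltW t0 /ltW ts]; apply: dF; rewrite t0.
  have [c cs] := MVT s0 dF cF.
  rewrite [X in _ = _ * X]subr0 => E; exists c; first exact: cs.
  rewrite -E /F /second_diff !scale0r !add0r opprB !addrA -!addrA.
  by congr (_ + (_ + _)); rewrite addrC.
move: (cs); rewrite in_itv /= => /andP[/ltW c0 /ltW cs'].
have c0s : 0 <= c <= s by rewrite c0.
have [d ds Ed] : exists2 d, d \in `]0, s[%R &
    'D_u f (c *: u + (s *: v + x)) - 'D_u f (c *: u + x) =
    'D_v ('D_u f) (c *: u + (d *: v + x)) * s.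
  pose F t := 'D_u f (t *: v + (c *: u + x)).
  have dF t : 0 <= t <= s -> is_derive t 1 F
      ('D_v ('D_u f) (t *: v + (c *: u + x))).
    move=> ts; apply: is_derive_line; apply: dDf.
    by have [+ _] := inb _ _ c0s ts; rewrite addrCA.
  have cF : {within `[0, s], continuous F}.
    by apply: derivable_within_continuous => t; rewrite in_itv/= => /dF[].
  have {}dF t : t \in `]0, s[%R -> is_derive t 1 F
      ('D_v ('D_u f) (t *: v + (c *: u + x))).
    by rewrite in_itv /= => /andP[/ltW t0 /ltW ts]; apply: dF; rewrite t0.
  have [d ds] := MVT s0 dF cF.
  rewrite [X in _ = _ * X]subr0 => E; exists d; first exact: ds.
  by rewrite addrCA [c *: u + (d *: v + x)]addrCA -E /F scale0r add0r.
move: (ds); rewrite in_itv /= => /andP[/ltW d0 /ltW ds'].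
rewrite Ec Ed -mulrA -expr2 mulfK ?expf_neq0 ?gt_eqF// distrC.
by have [] := inb c d c0s _; rewrite ?d0.
Qed.

(** The second difference is unchanged when [u] and [v] are swapped, so a single quotient lies
    within [e / 2] of both mixed derivatives. *)
Lemma derive_comm f D x u v : open D -> C_on 2 D f -> D x ->
  'D_u ('D_v f) x = 'D_v ('D_u f) x.
Proof.
move=> oD Df Dx; apply/eqP; rewrite -subr_eq0 -normr_le0.
apply/ler_addgt0Pl => e e0; rewrite addr0.
have e2 : 0 < e / 2 by rewrite divr_gt0.
have [r1 r10 H1] := second_diff_near v u oD Df Dx e2.
have [r2 r20 H2] := second_diff_near u v oD Df Dx e2.
pose s := Num.min r1 r2 / 2.
have m0 : 0 < Num.min r1 r2 by rewrite lt_min r10.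
have sm : s < Num.min r1 r2 by rewrite /s; lra.
have s0 : 0 < s by rewrite /s; lra.
move: sm; rewrite lt_min => /andP[s1 s2].
have Hs1 : 0 < s < r1 by rewrite s0.
have Hs2 : 0 < s < r2 by rewrite s0.
move: (H1 s Hs1) (H2 s Hs2).
have E : second_diff f x v u s = second_diff f x u v s.
  by rewrite /second_diff addrCA; congr (_ + _); rewrite addrAC.
rewrite E; move: (_ / _) => q.
move: ('D_u ('D_v f) x) ('D_v ('D_u f) x) => a b Ha Hb.
have := ler_distD q a b; rewrite [`|a - q|]distrC; lra.
Qed.

End Schwarz.

(** * Closure properties of maps of class C^k *)

Section SmoothFunctions.
Local Open Scope ring_scope.
Local Open Scope classical_set_scope.
Context {R : realType} {V : normedModType R}.

Lemma near_eq_differentiable (W : normedModType R) (f g : V -> W) (x : V) :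
  (\near x, f x = g x) -> differentiable f x -> differentiable g x.
Proof.
move=> fg df; have gx : g x = f x by rewrite (nbhs_singleton fg).
have cf : continuous ('d f x) by exact: diff_continuous.
have E : g \o shift x = cst (g x) + 'd f x +o_ 0 id.
  apply/eqaddoP => e e0.
  have /eqaddoP/(_ e e0) := diff_locally df.
  have fg0 : \forall h \near 0, f (h + x) = g (h + x).
    by move: fg; rewrite (near_shift 0) subr0; exact: filterS.
  by apply: filterS2 fg0 => h /= fgh; rewrite /= !fctE /= fgh gx.
by apply/diff_locallyP; rewrite (diff_unique cf E).
Qed.

(** Differentiation rules hold only at points of [D], while [C_on] recurses on the total function
    ['D_v f]. Openness turns equality on [D] into equality near each point, which the derivatives
    respect. *)
Lemma C_on_eq (W : normedModType R) (D : set V) (f g : V -> W) k : open D ->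
  (forall x, D x -> f x = g x) -> C_on k D f -> C_on k D g.
Proof.
move=> oD; elim: k f g => [|k IH] f g fg /=.
  move=> cf x Dx; have nfg : \near x, f x = g x.
    by apply: filterS (open_nbhs_nbhs (conj oD Dx)) => y; exact: fg.
  suff : g @ x --> g x by [].
  by rewrite -(fg _ Dx); apply: cvg_trans (cf x Dx); exact: near_eq_cvg.
have nfg x : D x -> \near x, f x = g x.
  by move=> Dx; apply: filterS (open_nbhs_nbhs (conj oD Dx)) => y; exact: fg.
move=> [df Df]; split=> [x Dx|v].
  exact: near_eq_differentiable (nfg x Dx) (df x Dx).
apply: IH (Df v) => x Dx; exact: near_eq_derive (nfg x Dx).
Qed.

Lemma C_onS (W : normedModType R) (D : set V) (f : V -> W) k :
  C_on k.+1 D f -> C_on k D f.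
Proof.
elim: k f => [|k IH] f [df Df]; first by move=> x /df/differentiable_continuous.
by split=> // v; exact: IH.
Qed.

Lemma C_on_subset (W : normedModType R) (D D' : set V) (f : V -> W) k :
  D' `<=` D -> C_on k D f -> C_on k D' f.
Proof.
move=> sD; elim: k f => [|k IH] f /=; first by move=> cf x /sD/cf.
by move=> [df Df]; split=> [x /sD/df//|v]; exact: IH.
Qed.

Lemma derive_cst_fun (W : normedModType R) (a : W) v : 'D_v (cst a : V -> W) = cst 0.
Proof. by apply/funext => x; rewrite derive_cst. Qed.

Lemma C_on_cst (W : normedModType R) (D : set V) (a : W) k : C_on k D (cst a).
Proof.
elim: k a => [|k IH] a /=; first by move=> x _; exact: cvg_cst.
by split=> [x _|v]; [exact: differentiable_cst|rewrite derive_cst_fun].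
Qed.

Section RealValued.
Variable D : set V.
Hypothesis oD : open D.
Implicit Types f g : V -> R.

Lemma C_onD (W : normedModType R) (f g : V -> W) k :
  C_on k D f -> C_on k D g -> C_on k D (fun x => f x + g x).
Proof.
rewrite -[fun x => _]/(f + g); elim: k f g => [|k IH] f g /=.
  by move=> cf cg x Dx; apply: cvgD; [exact: cf|exact: cg].
move=> [df Df] [dg Dg]; split=> [x Dx|v].
  by apply: differentiableD; [exact: df|exact: dg].
apply: (C_on_eq oD _ (IH _ _ (Df v) (Dg v))) => x Dx.
by rewrite deriveD//; apply: diff_derivable; [exact: df|exact: dg].
Qed.

Lemma C_onZl (W : normedModType R) f (w : W) k :
  C_on k D f -> C_on k D (fun x => f x *: w).
Proof.
elim: k f => [|k IH] f.
  by move=> cf x Dx; apply: cvgZr_tmp; exact: cf.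
move=> [df Df]; split=> [x Dx|v].
  by apply: differentiableZl; exact: df.
apply: (C_on_eq oD _ (IH _ (Df v))) => x Dx.
rewrite [RHS]deriveE; last exact: differentiableZl (df x Dx).
by rewrite (diffZl _ (df x Dx)) /= -(deriveE v (df x Dx)).
Qed.

Lemma C_onM f g k : C_on k D f -> C_on k D g -> C_on k D (fun x => f x * g x).
Proof.
rewrite -[fun x => _]/(f * g).
elim: k f g => [|k IH] f g.
  by move=> cf cg x Dx; apply: cvgM; [exact: cf|exact: cg].
move=> Cf Cg; have [df Df] := Cf; have [dg Dg] := Cg; split=> [x Dx|v].
  by apply: differentiableM; [exact: df|exact: dg].
apply: (C_on_eq oD _ (C_onD (IH _ _ (C_onS Cf) (Dg v)) (IH _ _ (C_onS Cg) (Df v)))).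
move=> x Dx.
by rewrite deriveM//; apply: diff_derivable; [exact: df|exact: dg].
Qed.

(** The derivative of [1/f] is [-(1/f)^2 f'], so class [k.+1] only asks for class [k] of [1/f]
    itself. *)
Lemma C_onV f k : (forall x, D x -> f x != 0) -> C_on k D f ->
  C_on k D (fun x => (f x)^-1).
Proof.
move=> f0; elim: k f f0 => [|k IH] f f0.
  by move=> cf x Dx; apply: cvgV; [exact: f0|exact: cf].
move=> Cf; have [df Df] := Cf; split=> [x Dx|v].
  by apply: differentiableV; [exact: df|exact: f0].
have CV := IH f f0 (C_onS Cf).
apply: (C_on_eq oD _ (C_onM (C_on_cst D (-1 : R) k) (C_onM (C_onM CV CV) (Df v)))).
move=> x Dx; rewrite deriveV; [|exact: f0|apply: diff_derivable; exact: df].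
by rewrite !fctE /GRing.scale /= mulN1r mulNr expr2 invfM.
Qed.

Lemma C_on_expR f k : C_on k D f -> C_on k D (fun x => expR (f x)).
Proof.
elim: k f => [|k IH] f.
  move=> cf x Dx; apply: continuous_comp (cf x Dx) _.
  exact: continuous_expR.
have dexp (t : R) : differentiable (@expR R) t.
  by apply/derivable1_diffP; exact: derivable_expR.
move=> Cf; have [df Df] := Cf; split=> [x Dx|v].
  exact: differentiable_comp (df x Dx) (dexp _).
have CE := IH f (C_onS Cf).
apply: (C_on_eq oD _ (C_onM CE (Df v))) => x Dx.
rewrite [RHS]deriveE; last exact: differentiable_comp (df x Dx) (dexp _).
rewrite (diff_comp (df x Dx) (dexp _)) /= -(deriveE v (df x Dx)) diff1E//.
have -> : (expR^`() (f x))%classic = expR (f x).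
  by rewrite derive1E; have [_ ->] := is_derive_expR (f x).
by rewrite /GRing.scale /= mulrC.
Qed.

Lemma C_on_sum (W : normedModType R) (I : Type) (r : seq I) (P : pred I)
    (F : I -> V -> W) k :
  (forall i, P i -> C_on k D (F i)) ->
  C_on k D (fun x => \sum_(i <- r | P i) F i x).
Proof.
move=> CF; have -> : (fun x => \sum_(i <- r | P i) F i x) = \sum_(i <- r | P i) F i.
  by apply/funext => x; rewrite fct_sumE.
elim/big_ind : _ => //; last by move=> ? ?; exact: C_onD.
exact: (C_on_cst D (0 : W)).
Qed.

Lemma C_on_prod (I : Type) (r : seq I) (P : pred I) (F : I -> V -> R) k :
  (forall i, P i -> C_on k D (F i)) ->
  C_on k D (fun x => \prod_(i <- r | P i) F i x).
Proof.
move=> CF; elim: r => [|i r IH].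
  by apply: (C_on_eq oD _ (C_on_cst D (1 : R) k)) => x _; rewrite big_nil.
case: (boolP (P i)) => Pi.
  by apply: (C_on_eq oD _ (C_onM (CF i Pi) IH)) => x _; rewrite big_cons Pi.
by apply: (C_on_eq oD _ IH) => x _; rewrite big_cons (negPf Pi).
Qed.

Lemma C_on_coord p q (A : V -> 'M[R]_(p, q)) i j k :
  C_on k D A -> C_on k D (fun x => A x i j).
Proof.
elim: k A => [|k IH] A.
  move=> cA x Dx; exact: continuous_comp (cA x Dx) (@coord_continuous _ _ _ i j _).
move=> [dA DA]; split=> [x Dx|v].
  exact: differentiable_comp (dA x Dx) (differentiable_coord _ i j).
apply: (C_on_eq oD _ (IH _ (DA v))) => x Dx.
by rewrite derive_mx ?mxE//; exact: diff_derivable (dA x Dx).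
Qed.

Lemma C_on_mx p q (A : V -> 'M[R]_(p, q)) k :
  (forall i j, C_on k D (fun x => A x i j)) -> C_on k D A.
Proof.
move=> CA; have -> : A = fun x => \sum_i \sum_j A x i j *: delta_mx i j.
  by apply/funext => x; exact: matrix_sum_delta.
by apply: C_on_sum => i _; apply: C_on_sum => j _; exact: C_onZl.
Qed.

Lemma C_on_det p (A : V -> 'M[R]_p) k :
  (forall i j, C_on k D (fun x => A x i j)) -> C_on k D (fun x => \det (A x)).
Proof.
move=> CA; apply: C_on_sum => s _.
apply: C_onM; first exact: C_on_cst.
by apply: C_on_prod => i _; exact: CA.
Qed.

(** Cramer's rule: an entry of the inverse is a cofactor, with indices exchanged, over the
    determinant. *)
Lemma C_on_invmx p (A : V -> 'M[R]_p) k i j :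
  (forall x, D x -> A x \in unitmx) ->
  (forall i j, C_on k D (fun x => A x i j)) ->
  C_on k D (fun x => invmx (A x) i j).
Proof.
move=> uA CA.
have Cd : C_on k D (fun x => (\det (A x))^-1).
  by apply: C_onV (C_on_det CA) => x Dx; rewrite -unitfE -unitmxE uA.
have Cc : C_on k D (fun x => cofactor (A x) j i).
  apply: C_onM; first exact: C_on_cst.
  apply: C_on_det => a b; have := CA (lift j a) (lift i b).
  by under [X in _ -> C_on _ _ X]eq_fun do rewrite !mxE.
apply: (C_on_eq oD _ (C_onM Cd Cc)) => x Dx.
by rewrite /invmx uA// !mxE.
Qed.

End RealValued.
End SmoothFunctions.

(** * Derivatives along variable vector fields *)

Section Fields.
Local Open Scope ring_scope.
Local Open Scope classical_set_scope.
Context {R : realType} {m : nat}.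
Local Notation E := 'rV[R]_m.
Variable D : set E.
Hypothesis oD : open D.
Implicit Types (f z : E -> R) (X Y Z : E -> E) (u v w : E).

Lemma smooth_differentiable (W : normedModType R) (f : E -> W) x :
  smooth_on D f -> D x -> differentiable f x.
Proof. by move=> /(_ 1%N)[+ _]; apply. Qed.

Lemma smooth_derivable (W : normedModType R) (f : E -> W) x v :
  smooth_on D f -> D x -> derivable f x v.
Proof. by move=> sf Dx; apply: diff_derivable; exact: smooth_differentiable. Qed.

Lemma smooth_derive (W : normedModType R) (f : E -> W) v :
  smooth_on D f -> smooth_on D ('D_v f).
Proof. by move=> sf k; have [_ +] := sf k.+1; apply. Qed.

Lemma smooth_cst (W : normedModType R) (a : W) : smooth_on D (cst a : E -> W).
Proof. by move=> k; exact: C_on_cst. Qed.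

Lemma smooth_eq (W : normedModType R) (f g : E -> W) :
  (forall x, D x -> f x = g x) -> smooth_on D f -> smooth_on D g.
Proof. by move=> fg sf k; exact: C_on_eq oD fg (sf k). Qed.

Lemma smoothD (W : normedModType R) (f g : E -> W) :
  smooth_on D f -> smooth_on D g -> smooth_on D (fun x => f x + g x).
Proof. by move=> sf sg k; exact: C_onD. Qed.

Lemma smoothM f g :
  smooth_on D f -> smooth_on D g -> smooth_on D (fun x => f x * g x).
Proof. by move=> sf sg k; exact: C_onM. Qed.

Lemma smoothN f : smooth_on D f -> smooth_on D (fun x => - f x).
Proof.
move=> sf; apply: smooth_eq (smoothM (smooth_cst (-1 : R)) sf) => x _.
by rewrite mulN1r.
Qed.

Lemma smooth_sum (W : normedModType R) (I : finType) (F : I -> E -> W) :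
  (forall i, smooth_on D (F i)) -> smooth_on D (fun x => \sum_i F i x).
Proof. by move=> sF k; apply: C_on_sum => // i _; exact: sF. Qed.

Lemma smooth_coord p q (A : E -> 'M[R]_(p, q)) i j :
  smooth_on D A -> smooth_on D (fun x => A x i j).
Proof. by move=> sA k; exact: C_on_coord. Qed.

Lemma smooth_mx p q (A : E -> 'M[R]_(p, q)) :
  (forall i j, smooth_on D (fun x => A x i j)) -> smooth_on D A.
Proof. by move=> sA k; apply: C_on_mx => // i j; exact: sA. Qed.

Lemma smooth_row X : (forall i, smooth_on D (fun x => X x 0 i)) -> smooth_on D X.
Proof. by move=> sX; apply: smooth_mx => i j; rewrite ord1. Qed.

Lemma deriveDl (W : normedModType R) (f : E -> W) x u v : differentiable f x ->
  'D_(u + v) f x = 'D_u f x + 'D_v f x.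
Proof. by move=> df; rewrite !deriveE// linearD. Qed.

Lemma deriveZdir (W : normedModType R) (f : E -> W) x a v : differentiable f x ->
  'D_(a *: v) f x = a *: 'D_v f x.
Proof. by move=> df; rewrite !deriveE// linearZ. Qed.

Lemma derive_comm_smooth f x u v : smooth_on D f -> D x ->
  'D_u ('D_v f) x = 'D_v ('D_u f) x.
Proof. by move=> sf; exact: derive_comm. Qed.

Lemma smooth_dir f Y : smooth_on D f -> smooth_on D Y ->
  smooth_on D (fun y => 'D_(Y y) f y).
Proof.
move=> sf sY.
apply: (@smooth_eq _ (fun y => \sum_i Y y 0 i * 'D_(delta_mx 0 i) f y)).
  by move=> y Dy; rewrite [RHS]partial_dir//; exact: smooth_differentiable sf Dy.
apply: smooth_sum => i; apply: smoothM; first exact: smooth_coord.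
exact: smooth_derive.
Qed.

Lemma derive_dir f Y x u : smooth_on D f -> smooth_on D Y -> D x ->
  'D_u (fun y => 'D_(Y y) f y) x = 'D_u ('D_(Y x) f) x + 'D_('D_u Y x) f x.
Proof.
move=> sf sY Dx.
have expand Y' : smooth_on D Y' -> 'D_u (fun y => 'D_(Y' y) f y) x =
    \sum_i (Y' x 0 i * 'D_u ('D_(delta_mx 0 i) f) x
            + 'D_(delta_mx 0 i) f x * 'D_u Y' x 0 i).
  move=> sY'.
  have E : 'D_u (fun y => 'D_(Y' y) f y) x =
      'D_u (\sum_(i < m) ((fun y => Y' y 0 i) * 'D_(delta_mx 0 i) f)) x.
    apply: near_eq_derive; apply: filterS (open_nbhs_nbhs (conj oD Dx)) => y Dy.
    by rewrite partial_dir ?fct_sumE//; exact: smooth_differentiable sf Dy.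
  have dY i := smooth_derivable (v := u) (smooth_coord 0 i sY') Dx.
  have df i := smooth_derivable (v := u) (smooth_derive (delta_mx 0 i) sf) Dx.
  rewrite E derive_sum => [|i]; last exact: derivableM (dY i) (df i).
  apply: eq_bigr => i _; rewrite deriveM//; congr (_ + _ * _).
  by rewrite derive_coord//; exact: smooth_differentiable sY' Dx.
have E1 := expand _ sY.
have E2 : 'D_u ('D_(Y x) f) x = \sum_i Y x 0 i * 'D_u ('D_(delta_mx 0 i) f) x.
  apply: (etrans (expand _ (smooth_cst (Y x)))).
  by apply: eq_bigr => i _; rewrite derive_cst mxE mulr0 addr0.
have E3 := partial_dir ('D_u Y x) (smooth_differentiable sf Dx).
apply: (etrans E1); apply: etrans (congr2 +%R (esym E2) (esym E3)).
rewrite big_split; congr (_ + _).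
by apply: eq_bigr => i _; exact: mulrC.
Qed.

Lemma derive_coordE Z x u i : smooth_on D Z -> D x ->
  ('D_u Z x) 0 i = 'D_u (fun y => Z y 0 i) x.
Proof.
by move=> sZ Dx; rewrite derive_coord//; exact: smooth_differentiable sZ Dx.
Qed.

Lemma smooth_dirV Z Y : smooth_on D Z -> smooth_on D Y ->
  smooth_on D (fun y => 'D_(Y y) Z y).
Proof.
move=> sZ sY; apply: smooth_row => i.
apply: (smooth_eq _ (smooth_dir (smooth_coord 0 i sZ) sY)) => y Dy.
by rewrite derive_coord//; exact: smooth_differentiable sZ Dy.
Qed.

Lemma derive_dirV Z Y x u : smooth_on D Z -> smooth_on D Y -> D x ->
  'D_u (fun y => 'D_(Y y) Z y) x = 'D_u ('D_(Y x) Z) x + 'D_('D_u Y x) Z x.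
Proof.
move=> sZ sY Dx; apply/rowP => i; rewrite mxE.
have e1 := derive_coordE u i (smooth_dirV sZ sY) Dx.
have e2 := derive_coordE u i (smooth_derive (Y x) sZ) Dx.
have e3 := derive_coordE ('D_u Y x) i sZ Dx.
apply: (etrans e1); apply: etrans (congr2 +%R (esym e2) (esym e3)).
have near_coord (W : E -> E) :
    \near x, ('D_(W x) Z x) 0 i = 'D_(W x) (fun y => Z y 0 i) x.
  apply: filterS (open_nbhs_nbhs (conj oD Dx)) => y Dy; exact: derive_coordE.
apply: (etrans (near_eq_derive u (near_coord Y))).
apply: (etrans (derive_dir u (smooth_coord 0 i sZ) sY Dx)).
have e4 := near_eq_derive u (near_coord (cst (Y x))).
exact: (congr2 +%R (esym e4) erefl).
Qed.

Lemma derive_coord2 Z x u v i : smooth_on D Z -> D x ->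
  'D_u ('D_v (fun y => Z y 0 i)) x = ('D_u ('D_v Z) x) 0 i.
Proof.
move=> sZ Dx.
apply: etrans (esym (derive_coordE u i (smooth_derive v sZ) Dx)).
apply: near_eq_derive; apply: filterS (open_nbhs_nbhs (conj oD Dx)) => y Dy.
exact: esym (derive_coordE v i sZ Dy).
Qed.

Lemma derive_commV Z x u v : smooth_on D Z -> D x ->
  'D_u ('D_v Z) x = 'D_v ('D_u Z) x.
Proof.
move=> sZ Dx; apply/rowP => i.
apply: (etrans (esym (derive_coord2 u v i sZ Dx))).
apply: etrans (derive_coord2 v u i sZ Dx).
exact: derive_comm_smooth (smooth_coord 0 i sZ) Dx.
Qed.

End Fields.

(* The quadratic part of the connection: [nabla G X Y = 'D_X Y + gam G X Y]. *)
Definition gam (R : realType) (m : nat) (G : 'rV[R]_m -> 'M[R]_m)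
    (x u v : 'rV[R]_m) : 'rV[R]_m :=
  (\row_k \sum_i \sum_j christoffel G k i j x * u 0 i * v 0 j)%R.

(** This is the curvature evaluated on constant fields, whose Lie brackets vanish. *)
Definition curv (R : realType) (m : nat) (G : 'rV[R]_m -> 'M[R]_m)
    (x u v w : 'rV[R]_m) : 'rV[R]_m :=
  ('D_u (fun y => gam G y v w) x - 'D_v (fun y => gam G y u w) x
   + (gam G x u (gam G x v w) - gam G x v (gam G x u w)))%R.

(** * The curvature as a trilinear map at a point *)

Section Curvature.
Local Open Scope ring_scope.
Local Open Scope classical_set_scope.
Context {R : realType} {m : nat}.
Local Notation E := 'rV[R]_m.
Variables (D : set E) (G : E -> 'M[R]_m).
Hypothesis oD : open D.
Hypothesis sG : smooth_on D G.
Hypothesis symG : forall y, D y -> (G y)^T = G y.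
Hypothesis uG : forall y, D y -> G y \in unitmx.
Implicit Types (X Y Z : E -> E) (u v w : E).

Lemma gamDl x u v w : gam G x (u + v) w = gam G x u w + gam G x v w.
Proof.
apply/rowP => k; rewrite !mxE -big_split; apply: eq_bigr => i _ /=.
by rewrite -big_split; apply: eq_bigr => j _ /=; rewrite mxE; ring.
Qed.

Lemma gamZl x a u w : gam G x (a *: u) w = a *: gam G x u w.
Proof.
apply/rowP => k; rewrite !mxE mulr_sumr; apply: eq_bigr => i _ /=.
by rewrite mulr_sumr; apply: eq_bigr => j _ /=; rewrite mxE; ring.
Qed.

Lemma gamC x u v : D x -> gam G x u v = gam G x v u.
Proof.
move=> Dx; apply/rowP => k; rewrite !mxE exchange_big; apply: eq_bigr => i _.
apply: eq_bigr => j _; rewrite (christoffel_sym _ _ _ oD symG Dx); ring.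
Qed.

Lemma gamDr x u v w : gam G x w (u + v) = gam G x w u + gam G x w v.
Proof.
apply/rowP => k; rewrite !mxE -big_split; apply: eq_bigr => i _ /=.
by rewrite -big_split; apply: eq_bigr => j _ /=; rewrite mxE; ring.
Qed.

Lemma gamZr x a u w : gam G x w (a *: u) = a *: gam G x w u.
Proof.
apply/rowP => k; rewrite !mxE mulr_sumr; apply: eq_bigr => i _ /=.
by rewrite mulr_sumr; apply: eq_bigr => j _ /=; rewrite mxE; ring.
Qed.

Lemma smooth_christoffel k i j : smooth_on D (christoffel G k i j).
Proof.
have sp a b c : smooth_on D (partial a (fun y => G y b c)).
  by apply: smooth_derive; exact: smooth_coord.
apply: smoothM => //; first exact: smooth_cst.
apply: smooth_sum => // l; apply: smoothM => //.
  by move=> n; apply: C_on_invmx => // a b; exact: smooth_coord.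
apply: smoothD => //; last by apply: smoothN.
by apply: smoothD.
Qed.

Lemma smooth_gam X Y : smooth_on D X -> smooth_on D Y ->
  smooth_on D (fun y => gam G y (X y) (Y y)).
Proof.
move=> sX sY; apply: smooth_row => // k.
apply: (@smooth_eq _ _ _ oD _ (fun y => \sum_i \sum_j
    christoffel G k i j y * X y 0 i * Y y 0 j)) => [y _|]; first by rewrite mxE.
apply: smooth_sum => // i; apply: smooth_sum => // j.
apply: smoothM => //; last exact: smooth_coord.
by apply: smoothM => //; [exact: smooth_christoffel|exact: smooth_coord].
Qed.

Lemma derive_gam X Y x u : smooth_on D X -> smooth_on D Y -> D x ->
  'D_u (fun y => gam G y (X y) (Y y)) x = 'D_u (fun y => gam G y (X x) (Y x)) x
    + gam G x ('D_u X x) (Y x) + gam G x (X x) ('D_u Y x).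
Proof.
move=> sX sY Dx.
have expand X' Y' k : smooth_on D X' -> smooth_on D Y' ->
    ('D_u (fun y => gam G y (X' y) (Y' y)) x) 0 k =
    \sum_i \sum_j ('D_u (christoffel G k i j) x * X' x 0 i * Y' x 0 j
      + christoffel G k i j x * ('D_u X' x) 0 i * Y' x 0 j
      + christoffel G k i j x * X' x 0 i * ('D_u Y' x) 0 j).
  move=> sX' sY'.
  rewrite -derive_coord; last exact: smooth_differentiable (smooth_gam sX' sY') Dx.
  have -> : (fun y => gam G y (X' y) (Y' y) 0 k) =
     \sum_i \sum_j (christoffel G k i j * (fun y => X' y 0 i) * (fun y => Y' y 0 j)).
    apply/funext => y; rewrite mxE fct_sumE; apply: eq_bigr => i _.
    by rewrite fct_sumE.
  have dc i j : is_derive x u (christoffel G k i j) ('D_u (christoffel G k i j) x).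
    by apply: derivableP; exact: smooth_derivable (smooth_christoffel _ _ _) Dx.
  have dv Z i : smooth_on D Z -> is_derive x u (fun y => Z y 0 i) ('D_u Z x 0 i).
    move=> sZ; rewrite -derive_coord; last exact: smooth_differentiable sZ Dx.
    by apply: derivableP; exact: smooth_derivable (smooth_coord oD _ _ sZ) Dx.
  have dS : is_derive x u
     (\sum_i \sum_j
       (christoffel G k i j * (fun y => X' y 0 i) * (fun y => Y' y 0 j)))
     (\sum_i \sum_j ((christoffel G k i j x * X' x 0 i) *: ('D_u Y' x) 0 j
        + Y' x 0 j *: (christoffel G k i j x *: ('D_u X' x) 0 i
          + X' x 0 i *: 'D_u (christoffel G k i j) x))).
    apply: is_derive_sum => i; apply: is_derive_sum => j.
    have dXG := is_deriveM (dc i j) (dv X' i sX').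
    exact: (is_deriveM dXG (dv Y' j sY')).
  rewrite (derive_val (is_derive := dS)).
  by apply: eq_bigr => i _; apply: eq_bigr => j _; rewrite /GRing.scale /=; ring.
apply/rowP => k; rewrite 2!mxE (expand _ _ _ sX sY).
rewrite (expand _ _ _ (smooth_cst D (X x)) (smooth_cst D (Y x))) !mxE -!big_split /=.
apply: eq_bigr => i _; rewrite -!big_split; apply: eq_bigr => j _ /=.
by rewrite !derive_cst !mxE; ring.
Qed.

(** Tensoriality: second derivatives of [Z] cancel by symmetry, the terms in the derivatives of [X]
    and [Y] cancel against the bracket, and those pairing [gam] with a derivative of [Z] cancel
    between the two orders. *)
Lemma curvatureE X Y Z x : smooth_on D X -> smooth_on D Y -> smooth_on D Z ->
  D x -> curvature G X Y Z x = curv G x (X x) (Y x) (Z x).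
Proof.
move=> sX sY sZ Dx.
have nablaE X' Y' y : nabla G X' Y' y = 'D_(X' y) Y' y + gam G y (X' y) (Y' y) by [].
have nn X' Y' : smooth_on D X' -> smooth_on D Y' ->
    nabla G X' (nabla G Y' Z) x = 'D_(X' x) ('D_(Y' x) Z) x
      + 'D_('D_(X' x) Y' x) Z x + ('D_(X' x) (fun y => gam G y (Y' x) (Z x)) x
    + gam G x ('D_(X' x) Y' x) (Z x) + gam G x (Y' x) ('D_(X' x) Z x))
    + (gam G x (X' x) ('D_(Y' x) Z x) + gam G x (X' x) (gam G x (Y' x) (Z x))).
  move=> sX' sY'; rewrite nablaE nablaE gamDr; congr (_ + _).
  have sd := smooth_dirV oD sZ sY'; have sg := smooth_gam sY' sZ.
  have -> : nabla G Y' Z =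
     (fun y => 'D_(Y' y) Z y) + (fun y => gam G y (Y' y) (Z y)) by [].
  rewrite deriveD; [|exact: smooth_derivable sd Dx|exact: smooth_derivable sg Dx].
  by rewrite (derive_dirV oD _ sZ sY' Dx) (derive_gam _ sY' sZ Dx).
have dZ := smooth_differentiable sZ Dx.
rewrite /curvature (nn _ _ sX sY) (nn _ _ sY sX) nablaE /lie_bracket /curv.
rewrite (derive_commV oD (X x) (Y x) sZ Dx).
have -> (a b : E) : 'D_(a - b) Z x = 'D_a Z x - 'D_b Z x.
  by rewrite -scaleN1r deriveDl// deriveZdir// scaleN1r.
have -> (a b : E) : gam G x (a - b) (Z x) = gam G x a (Z x) - gam G x b (Z x).
  by rewrite -scaleN1r gamDl gamZl scaleN1r.
do ![move: ('D_(_) _ x) => ?]; do ![move: (gam G x _ _) => ?].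
by apply/rowP => k; rewrite !mxE; ring.
Qed.

End Curvature.

Lemma form2_bilin (R : realType) (m : nat) (B : 'rV[R]_m -> 'rV[R]_m -> R) :
  (forall u v w, B (u + v) w = B u w + B v w)%R ->
  (forall a u w, B (a *: u) w = a * B u w)%R ->
  (forall u v w, B w (u + v) = B w u + B w v)%R ->
  (forall a u w, B w (a *: u) = a * B w u)%R ->
  forall u w,
  form2 (\matrix_(i, j) B (delta_mx ord0 i) (delta_mx ord0 j)) u w = B u w.
Proof.
move=> Dl Zl Dr Zr u w.
have sl (I : finType) (c : I -> R) (z : I -> 'rV[R]_m) y :
    B (\sum_i c i *: z i)%R y = (\sum_i c i * B (z i) y)%R.
  have B0 : B 0%R y = 0%R by rewrite -(scale0r (0 : 'rV[R]_m)%R) Zl mul0r.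
  rewrite (big_morph (B^~ y) (fun a b => Dl a b y) B0).
  by apply: eq_bigr => i _; rewrite Zl.
have sr (I : finType) (c : I -> R) (z : I -> 'rV[R]_m) y :
    B y (\sum_i c i *: z i)%R = (\sum_i c i * B y (z i))%R.
  have B0 : B y 0%R = 0%R by rewrite -(scale0r (0 : 'rV[R]_m)%R) Zr mul0r.
  rewrite (big_morph (B y) (fun a b => Dr a b y) B0).
  by apply: eq_bigr => i _; rewrite Zr.
rewrite form2E [in RHS](row_sum_delta w) sr; apply: eq_bigr => j _.
rewrite [in RHS](row_sum_delta u) sl mulrC; congr (_ * _)%R.
by apply: eq_bigr => i _; rewrite mxE.
Qed.

(** * Conformal change of the metric *)

Section Conformal.
Local Open Scope ring_scope.
Local Open Scope classical_set_scope.
Context {R : realType} {m : nat}.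
Local Notation E := 'rV[R]_m.
Variables (D : set E) (G : E -> 'M[R]_m) (f : E -> R).
Hypothesis oD : open D.
Hypothesis sG : smooth_on D G.
Hypothesis symG : forall y, D y -> (G y)^T = G y.
Hypothesis uG : forall y, D y -> G y \in unitmx.
Hypothesis sf : smooth_on D f.
Implicit Types (u v w : E).

Let df y : D y -> differentiable f y.
Proof. exact: smooth_differentiable. Qed.

Lemma smooth_conf : smooth_on D (fun y => expR (2 * f y) *: G y).
Proof.
apply: smooth_mx => // i j.
apply: (@smooth_eq _ _ _ oD _ (fun y => expR (2 * f y) * G y i j)) => [y _|].
  by rewrite mxE.
apply: smoothM => //; last exact: smooth_coord.
by move=> k; apply: C_on_expR => //; apply: smoothM => //; exact: smooth_cst.
Qed.

Lemma conf_unit y : D y -> expR (2 * f y) *: G y \in unitmx.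
Proof.
by move=> Dy; rewrite unitmxZ ?uG// unitfE gt_eqF ?expR_gt0.
Qed.

Let h (y : E) : 'M[R]_m := expR (2 * f y) *: G y.
Let grad (y : E) : E := (\row_l partial l f y) *m invmx (G y).

Let smooth_grad : smooth_on D grad.
Proof.
apply: smooth_row => // k.
apply: (@smooth_eq _ _ _ oD _ (fun y => \sum_l partial l f y * invmx (G y) l k)).
  by move=> y _; rewrite /grad mxE; apply: eq_bigr => l _; rewrite mxE.
apply: smooth_sum => // l; apply: smoothM => //; first exact: smooth_derive.
by move=> n; apply: C_on_invmx => // a b; exact: smooth_coord.
Qed.

Let form2_grad y w : D y -> form2 (G y) (grad y) w = 'D_w f y.
Proof.
move=> Dy; apply: etrans (esym (partial_dir w (df Dy))).
rewrite /form2 /grad mulmxKV ?uG// mxE.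
by apply: eq_bigr => i _; rewrite !mxE mulrC.
Qed.

(** Differentiating [exp(2f) G] adds [2 df G] to each of the three derivatives of the metric, and
    the exponential cancels against the inverse metric. Contracted, two of the added terms become
    Kronecker deltas and the third the gradient. *)
Let christoffel_conf y k i j : D y -> christoffel h k i j y =
  christoffel G k i j y + partial i f y * (k == j)%:R
  + partial j f y * (k == i)%:R - G y i j * grad y 0 k.
Proof.
move=> Dy.
have dh a b c : partial a (fun z => h z b c) y = expR (2 * f y) *
    (2 * partial a f y * G y b c + partial a (fun z => G z b c) y).
  have de : is_derive y (delta_mx 0 a) (fun z => expR (2 * f z))
      (2 * partial a f y * expR (2 * f y)).
    have d2 : is_derive y (delta_mx 0 a) (fun z => 2 * f z) (2 * partial a f y).
      apply: (is_derive_eq (is_deriveZ 2 (derivableP (diff_derivable (df Dy))))).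
      by [].
    have dexp t : differentiable (@expR R) t.
      by apply/derivable1_diffP; exact: derivable_expR.
    have d2f : differentiable (fun z => 2 * f z) y by exact: differentiableZ (df Dy).
    apply: DeriveDef.
      by apply: diff_derivable; exact: differentiable_comp d2f (dexp _).
    rewrite deriveE; last exact: differentiable_comp d2f (dexp _).
    rewrite (diff_comp d2f (dexp _)) /= -(deriveE _ d2f) diff1E//.
    by rewrite derive1E; have [_ ->] := is_derive_expR (2 * f y); rewrite derive_val.
  have dG : is_derive y (delta_mx 0 a) (fun z => G z b c)
      (partial a (fun z => G z b c) y).
    by apply: derivableP; exact: smooth_derivable (smooth_coord oD _ _ sG) Dy.
  have hE : (fun z => h z b c) = (fun z => expR (2 * f z)) * (fun z => G z b c).
    by apply/funext => z; rewrite mxE.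
  rewrite hE; apply: (etrans (derive_val (is_derive := is_deriveM de dG))).
  by rewrite /GRing.scale /=; do ![move: (partial _ _ y) => ?]; ring.
have e0 : expR (2 * f y) != 0 by rewrite gt_eqF ?expR_gt0.
have ih : invmx (h y) = (expR (2 * f y))^-1 *: invmx (G y).
  by rewrite /h invmxZ// unitmxZ ?unitfE// uG.
have delta a b : \sum_l invmx (G y) a l * G y b l = (a == b)%:R.
  have := congr1 (fun M : 'M[R]_m => M a b) (mulVmx (uG Dy)); rewrite !mxE => <-.
  by apply: eq_bigr => l _; congr (_ * _); rewrite -{1}(symG Dy) mxE.
have gradE : grad y 0 k = \sum_l invmx (G y) k l * partial l f y.
  have si : (invmx (G y))^T = invmx (G y) by rewrite trmx_inv symG.
  by rewrite mxE; apply: eq_bigr => l _; rewrite mulrC -{1}si !mxE.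
(* With the deltas and the gradient written as sums over [l], the two sides agree term by term. *)
rewrite gradE -!delta /christoffel !mulr_sumr -!sumrN -!big_split /=.
apply: eq_bigr => l _; rewrite ih mxE !dh.
do ![move: (partial _ _ y) => ?]; move: (invmx _ _ _) (expR _) e0 => ? c c0.
by field.
Qed.

Let vec (a b c d : E) (p q r : R) k :
  (a + p *: b + q *: c - r *: d) 0 k = a 0 k + p * b 0 k + q * c 0 k - r * d 0 k.
Proof. by rewrite !mxE. Qed.

Let gam_conf y u v : D y -> gam h y u v = gam G y u v
  + 'D_u f y *: v + 'D_v f y *: u - form2 (G y) u v *: grad y.
Proof.
move=> Dy; apply/rowP => k.
have pick (a : R) w : \sum_j a * (k == j)%:R * w 0 j = a * w 0 k.
  rewrite (bigD1 k)//= eqxx mulr1 big1 ?addr0// => j jk.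
  by rewrite eq_sym (negPf jk) mulr0 mul0r.
have dirE a b : 'D_a f y * b = \sum_i partial i f y * a 0 i * b.
  rewrite -mulr_suml; congr (_ * b); apply: (etrans (partial_dir a (df Dy))).
  by apply: eq_bigr => i _; rewrite mulrC.
have e2 : \sum_i \sum_j partial i f y * u 0 i * (k == j)%:R * v 0 j =
    'D_u f y * v 0 k.
  by rewrite dirE; apply: eq_bigr => i _; rewrite pick.
have e3 : \sum_i \sum_j partial j f y * v 0 j * (k == i)%:R * u 0 i =
    'D_v f y * u 0 k.
  by rewrite exchange_big dirE; apply: eq_bigr => i _; rewrite pick.
have e4 : \sum_i \sum_j G y i j * u 0 i * v 0 j * grad y 0 k =
    form2 (G y) u v * grad y 0 k.
  rewrite exchange_big form2E mulr_suml; apply: eq_bigr => j _.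
  by rewrite !mulr_suml; apply: eq_bigr => i _; congr (_ * _ * _); exact: mulrC.
have gamE (A : E -> 'M[R]_m) : gam A y u v 0 k =
    \sum_i \sum_j christoffel A k i j y * u 0 i * v 0 j by rewrite mxE.
rewrite vec -e2 -e3 -e4 !gamE -sumrN -!big_split; apply: eq_bigr => i _ /=.
rewrite -sumrN -!big_split; apply: eq_bigr => j _ /=.
by rewrite christoffel_conf//; ring.
Qed.

Let hess x u w := 'D_u ('D_w f) x - 'D_(gam G x u w) f x.

(** Differentiate [G(grad f, w) = 'D_w f] along [u] for a constant [w]: by metric compatibility, the
    term in which the connection acts on [w] is the correction that makes the Hessian covariant. *)
Let nabla_grad x u w : D x ->
  form2 (G x) ('D_u grad x + gam G x u (grad x)) w = hess x u w.
Proof.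
move=> Dx.
have dG i j : differentiable (fun y => G y i j : R) x.
  exact: smooth_differentiable (smooth_coord oD _ _ sG) Dx.
have dg := smooth_differentiable smooth_grad Dx.
have := nabla_metric (cst u) oD symG Dx (uG Dx) dG dg (differentiable_cst w x).
rewrite /nabla -/(gam G x u (grad x)) -/(gam G x u w) derive_cst add0r form2_grad//.
have -> : 'D_u (fun y => form2 (G y) (grad y) w) x = 'D_u ('D_w f) x.
  apply: near_eq_derive; apply: filterS (open_nbhs_nbhs (conj oD Dx)) => y Dy.
  exact: form2_grad.
by rewrite /hess => ->; rewrite addrK.
Qed.

Let derive_form2G x u v w : D x ->
  'D_u (fun y => form2 (G y) v w) x =
  form2 (G x) (gam G x u v) w + form2 (G x) v (gam G x u w).
Proof.
move=> Dx.
have dG i j : differentiable (fun y => G y i j : R) x.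
  exact: smooth_differentiable (smooth_coord oD _ _ sG) Dx.
have := nabla_metric (cst u) oD symG Dx (uG Dx) dG
  (differentiable_cst v x) (differentiable_cst w x).
by rewrite /nabla -/(gam G x u v) -/(gam G x u w) !derive_cst !add0r.
Qed.

Let smooth_form2 v w : smooth_on D (fun y => form2 (G y) v w).
Proof.
apply: (@smooth_eq _ _ _ oD _ (fun y => \sum_j (\sum_i v 0 i * G y i j) * w 0 j)).
  by move=> y _; rewrite form2E.
apply: smooth_sum => // j; apply: smoothM => //; last exact: smooth_cst.
apply: smooth_sum => // i; apply: smoothM => //; first exact: smooth_cst.
exact: smooth_coord.
Qed.

Let derive_gam_conf x u v w : D x ->
  'D_u (fun y => gam h y v w) x = 'D_u (fun y => gam G y v w) x
    + 'D_u ('D_v f) x *: w + 'D_u ('D_w f) x *: v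
    - ('D_u (fun y => form2 (G y) v w) x *: grad x
       + form2 (G x) v w *: 'D_u grad x).
Proof.
move=> Dx; apply/rowP => k.
have sgG : smooth_on D (fun y => gam G y v w) :=
  smooth_gam oD sG uG (smooth_cst D v) (smooth_cst D w).
have sgh : smooth_on D (fun y => gam h y v w) :=
  smooth_gam oD smooth_conf conf_unit (smooth_cst D v) (smooth_cst D w).
have Eh := derive_coordE u k sgh Dx.
apply: (etrans Eh).
pose F1 (y : E) : R := gam G y v w 0 k.
pose F2 (y : E) : R := 'D_v f y * w 0 k.
pose F3 (y : E) : R := 'D_w f y * v 0 k.
pose F4 (y : E) : R := form2 (G y) v w * grad y 0 k.
have E1 : 'D_u (fun y => gam h y v w 0 k) x = 'D_u (F1 + F2 + F3 - F4) x.
  apply: near_eq_derive; apply: filterS (open_nbhs_nbhs (conj oD Dx)) => y Dy.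
  by rewrite gam_conf// vec.
have dsm (W : E -> R) : smooth_on D W -> is_derive x u W ('D_u W x).
  by move=> sW; apply: derivableP; exact: smooth_derivable sW Dx.
have d1 : is_derive x u F1 (('D_u (fun y => gam G y v w) x) 0 k).
  rewrite (derive_coordE u k sgG Dx); apply: dsm; exact: smooth_coord sgG.
have dMc (W : E -> R) c : smooth_on D W ->
    is_derive x u (fun y => W y * c) ('D_u W x * c).
  move=> /dsm dW; apply: (is_derive_eq (is_deriveM dW (is_derive_cst c x u))).
  by rewrite scaler0 add0r; exact: mulrC.
have d2 : is_derive x u F2 ('D_u ('D_v f) x * w 0 k).
  by apply: dMc; exact: smooth_derive.
have d3 : is_derive x u F3 ('D_u ('D_w f) x * v 0 k).
  by apply: dMc; exact: smooth_derive.
have d4 : is_derive x u F4 (form2 (G x) v w * ('D_u grad x) 0 k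
    + grad x 0 k * 'D_u (fun y => form2 (G y) v w) x).
  have dg : is_derive x u (fun y => grad y 0 k) (('D_u grad x) 0 k).
    by rewrite (derive_coordE u k smooth_grad Dx); apply: dsm; exact: smooth_coord.
  exact: is_deriveM (dsm _ (smooth_form2 v w)) dg.
have dF := is_deriveB (is_deriveD (is_deriveD d1 d2) d3) d4.
apply: (etrans E1); apply: (etrans (derive_val (is_derive := dF))).
have vec2 (a b c d1' d2' : E) (p q r s : R) :
    (a + p *: b + q *: c - (r *: d1' + s *: d2')) 0 k =
    a 0 k + p * b 0 k + q * c 0 k - (r * d1' 0 k + s * d2' 0 k).
  by rewrite !mxE.
apply: etrans (esym (vec2 _ _ _ _ _ _ _ _ _)); congr (_ + _ + _ - _).
by rewrite addrC; congr (_ + _); exact: mulrC.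
Qed.

Let normg x := form2 (G x) (grad x) (grad x).

(** In dimension at least 3 this is the Schouten tensor of [G] minus that of [h], hence the Schouten
    tensor of [G] when [h] is flat. *)
Let Tf x u w := hess x u w - 'D_u f x * 'D_w f x + normg x / 2 * form2 (G x) u w.

Let conf_tensor x : 'M[R]_m :=
  \matrix_(i, j) Tf x (delta_mx 0 i) (delta_mx 0 j).

Let TfC x u w : D x -> Tf x u w = Tf x w u.
Proof.
move=> Dx; rewrite /Tf /hess (derive_comm_smooth oD u w sf Dx) (gamC oD symG u w Dx).
by rewrite (form2_sym u w (symG Dx)) (mulrC ('D_u f x)).
Qed.

Let TfDl x u v w : D x -> Tf x (u + v) w = Tf x u w + Tf x v w.
Proof.
move=> Dx; rewrite /Tf /hess gamDl !(deriveDl _ _ (df Dx)) form2Dl.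
rewrite (deriveDl _ _ (smooth_differentiable (smooth_derive _ sf) Dx)).
by do ![move: ('D_ _ _ x) => ?]; move: (form2 _ _ _) (form2 _ _ _) => ? ?; ring.
Qed.

Let TfZl x a u w : D x -> Tf x (a *: u) w = a * Tf x u w.
Proof.
move=> Dx; rewrite /Tf /hess gamZl !(deriveZdir _ _ (df Dx)) form2Zl.
rewrite (deriveZdir _ _ (smooth_differentiable (smooth_derive _ sf) Dx)).
rewrite /GRing.scale /=.
by do ![move: ('D_ _ _ x) => ?]; move: (form2 _ _ _) => ?; ring.
Qed.

Let TfE x u w : D x -> form2 (conf_tensor x) u w = Tf x u w.
Proof.
move=> Dx; apply: form2_bilin => [a b c|a b c|a b c|a b c].
- exact: TfDl.
- exact: TfZl.
- by rewrite TfC// TfDl// !(TfC _ c).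
- by rewrite TfC// TfZl// (TfC _ c).
Qed.

Let conf_tensor_sym x : D x -> (conf_tensor x)^T = conf_tensor x.
Proof. by move=> Dx; apply/matrixP => i j; rewrite !mxE TfC. Qed.

Let confQ x := conf_tensor x *m invmx (G x).

Let confQG x : D x -> confQ x *m G x = conf_tensor x.
Proof. by move=> Dx; rewrite mulmxKV ?uG. Qed.

(** Pairing either side with [w] gives [Tf x u w], and [G] is nondegenerate. This vector form of [Q]
    is the one that appears when the new connection is differentiated. *)
Let confQE x u : D x -> u *m confQ x = 'D_u grad x + gam G x u (grad x)
  - 'D_u f x *: grad x + (normg x / 2) *: u.
Proof.
move=> Dx; apply/eqP; rewrite -subr_eq0; apply/eqP.
apply: (form2_nondeg (uG Dx)) => w.
rewrite -scaleN1r form2Dl form2Zl mulN1r form2_mull (confQG Dx) (TfE _ _ Dx).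
rewrite form2Dl -scaleNr form2Dl !form2Zl (nabla_grad _ _ Dx) (form2_grad _ Dx).
by rewrite /Tf mulNr subrr.
Qed.

(** The curvature is of type (1,3), so no power of [exp(2f)] is left. The three auxiliary expansions
    [gl], [dl] and [fl] handle the products of connection terms. *)
Let curv_conf x u v w : D x -> curv h x u v w =
  curv G x u v w - kn_curv (G x) (conf_tensor x) (confQ x) u v w.
Proof.
move=> Dx.
have gl a b c d (p q r : R) : gam G x a (b + p *: c + q *: d - r *: grad x) =
    gam G x a b + p *: gam G x a c + q *: gam G x a d - r *: gam G x a (grad x).
  by rewrite -scaleNr !gamDr !gamZr scaleNr.
have dl b c d (p q r : R) : 'D_(b + p *: c + q *: d - r *: grad x) f x =
    'D_b f x + p * 'D_c f x + q * 'D_d f x - r * normg x.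
  rewrite -scaleNr !(deriveDl _ _ (df Dx)) !(deriveZdir _ _ (df Dx)) scaleNr.
  by rewrite /normg (form2_grad (grad x) Dx).
have fl a b c d (p q r : R) : form2 (G x) a (b + p *: c + q *: d - r *: grad x) =
    form2 (G x) a b + p * form2 (G x) a c + q * form2 (G x) a d - r * 'D_a f x.
  rewrite -scaleNr !form2Dr !form2Zr (form2_sym a (grad x) (symG Dx)) mulNr.
  by rewrite (form2_grad a Dx).
rewrite /curv /kn_curv !(derive_gam_conf _ _ _ Dx) !(gam_conf _ _ Dx) !gl !dl !fl.
rewrite !(TfE _ _ Dx) !(confQE _ Dx) !(derive_form2G _ _ _ Dx) /Tf /hess.
(* The symmetric quantities in [u] and [v] are put in one order; what remains is a polynomial
   identity in the coordinates of opaque vectors. *)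
rewrite (gamC oD symG v u Dx) (derive_comm_smooth oD v u sf Dx).
rewrite (form2_sym v u (symG Dx)); move: (normg x) => n.
do ![move: (form2 _ _ _) => ?]; do ![move: ('D_ _ ('D_ _ f) x) => ?].
do ![move: ('D_ _ f x) => ?]; do ![move: ('D_ _ _ x) => ?].
do ![move: (gam G x _ _) => ?]; move: (grad x) => ?.
by apply/rowP => k; rewrite !mxE; field.
Qed.

Lemma conformally_flat_curv x :
  D x -> (forall u v w, curv (fun y => expR (2 * f y) *: G y) x u v w = 0) ->
  exists T Q : 'M[R]_m, [/\ T^T = T, Q *m G x = T &
    forall u v w, curv G x u v w = kn_curv (G x) T Q u v w].
Proof.
move=> Dx h0; exists (conf_tensor x), (confQ x); split.
- exact: conf_tensor_sym.
- exact: confQG.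
- by move=> u v w; apply/subr0_eq; rewrite -(curv_conf _ _ _ Dx) h0.
Qed.

End Conformal.

(** * From charts to the pointwise statement *)

Section Manifold.
Local Open Scope ring_scope.
Local Open Scope classical_set_scope.
Context {R : realType} {m : nat} (M : smooth_manifold R m).
Local Notation E := 'rV[R]_m.

(** The atlas gives openness only for the image of a full chart domain; continuity of [coord_inv]
    cuts out the part lying over [U]. *)
Lemma chart_image_open (c : chart M) (U : set M) : open U -> open (chart_image c U).
Proof.
move=> oU; rewrite openE => _ [p [Up cp] <-].
have Dp : (Defs.coord c @` dom c) (Defs.coord c p) by exists p.
have pU : \forall y \near Defs.coord c p, U (coord_inv c y).
  by apply: (coord_inv_continuous Dp); rewrite coordK//; exact: open_nbhs_nbhs.
suff : nbhs (Defs.coord c p) (chart_image c U) by [].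
have oc := @coord_open _ _ M c.
apply: filterS (filterI pU (open_nbhs_nbhs (conj oc Dp))).
by move=> y [Uy [q cq qy]]; exists q => //; split=> //; rewrite -(coordK cq) qy.
Qed.

Lemma conformally_flat_weakly_para_cosymplectic_flat
  (phi : chart M -> E -> 'M[R]_m) (xi : chart M -> E -> E)
  (eta : chart M -> E -> 'cV[R]_m) (g : chart M -> E -> 'M[R]_m) :
  (4 < m)%N ->
  weakly_para_cosymplectic phi xi eta g ->
  locally_conformally_flat g -> locally_flat g.
Proof.
move=> m4 [[[[[sphi _] _ _ [[sg _] symg ug]] acm] _ _] comm] lcf.
move=> c X Y Z sX sY sZ x Dx.
pose D := chart_image c setT.
have oD : open D by apply: chart_image_open; exact: openT.
rewrite (curvatureE oD (sg c) (ug c))//.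
move: (X x) (Y x) (Z x) => u v w {X Y Z sX sY sZ}.
have [p [_ cp] px] := Dx.
have [U [f [oU Up sf fl]]] := lcf p.
(* The commutation relation lives on the whole chart, the conformal factor only over [U]. Both are
   read through [curv (g c) x], on constant fields, so they can be combined at [x]. *)
pose D' := chart_image c U.
have oD' : open D' by exact: chart_image_open.
have D'x : D' x by exists p.
have sD y : D' y -> D y by move=> [q [_ cq] qy]; exists q.
have sg' : smooth_on D' (g c) by move=> k; exact: C_on_subset sD (sg c k).
have symg' y : D' y -> (g c y)^T = g c y by move=> /sD; exact: symg.
have ug' y : D' y -> g c y \in unitmx by move=> /sD; exact: ug.
have [|T [Q [symT QG cE]]] := conformally_flat_curv oD' sg' symg' ug' (sf c) D'x.
  move=> a b d; have := fl c (cst a) (cst b) (cst d)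
    (smooth_cst _ a) (smooth_cst _ b) (smooth_cst _ d) x D'x.
  by rewrite (curvatureE oD' (smooth_conf oD' sg' (sf c))
    (conf_unit (f \o coord_inv c) ug')
    (smooth_cst D' a) (smooth_cst D' b) (smooth_cst D' d) D'x).
have [F2 ex1 FG eE] := acm c x Dx.
have kc a b d : kn_curv (g c x) T Q a b (d *m phi c x)
    = kn_curv (g c x) T Q a b d *m phi c x.
  (* The image of a constant field under [phi] is no longer constant, so its curvature is obtained
     from tensoriality, which asks for smoothness. *)
  have sphid : smooth_on D (fun y => d *m phi c y).
    apply: smooth_row => // i.
    apply: (@smooth_eq _ _ _ oD _ (fun y => \sum_j d 0 j * phi c y j i)).
      by move=> y _; rewrite mxE.
    apply: smooth_sum => // j; apply: smoothM => //; first exact: smooth_cst.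
    exact: smooth_coord (sphi c).
  have := comm c (cst a) (cst b) (cst d)
    (smooth_cst _ a) (smooth_cst _ b) (smooth_cst _ d) x Dx.
  rewrite (curvatureE oD (sg c) (ug c) (smooth_cst D a) (smooth_cst D b) sphid Dx).
  rewrite (curvatureE oD (sg c) (ug c) (smooth_cst D a) (smooth_cst D b)
    (smooth_cst D d) Dx).
  by rewrite /= !cE.
have T0 := para_kn_tensor0 m4 F2 ex1 FG eE (symg c x Dx) (ug c x Dx) symT QG kc.
have Q0 : Q = 0 by rewrite -(mulmxK (ug c x Dx) Q) QG T0 mul0mx.
rewrite cE /kn_curv T0 Q0 /form2 !mulmx0 !mul0mx mxE.
by rewrite !scale0r !scaler0 !subr0 addr0.
Qed.

End Manifold.

Theorem theorem3 (R : realType) (n : nat) (n_ge2 : (2 <= n)%N)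
  (M : smooth_manifold R (2 * n + 1))
  (phi : chart M -> 'rV[R]_(2 * n + 1) -> 'M[R]_(2 * n + 1))
  (xi : chart M -> 'rV[R]_(2 * n + 1) -> 'rV[R]_(2 * n + 1))
  (eta : chart M -> 'rV[R]_(2 * n + 1) -> 'cV[R]_(2 * n + 1))
  (g : chart M -> 'rV[R]_(2 * n + 1) -> 'M[R]_(2 * n + 1)) :
  weakly_para_cosymplectic phi xi eta g ->
  locally_conformally_flat g ->
  locally_flat g.
Proof.
apply: conformally_flat_weakly_para_cosymplectic_flat.
by rewrite addn1 ltnS (leq_mul2l 2 2 n).
Qed.
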